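(* For each integer $m\ge2$, $$\mathcal C_2(m,(1,\tau))=\sqrt{\tau}^{\,(-1)^m}\prod_{k=1}^{m-1}\left(\tan\left(\frac{k\pi}{2\tau}\right)\right)^{(-1)^{m+k-1}}.$$
   Context: Here $\tau$ is a positive real parameter; the functions below are first defined for positive real parameters and for $\mathrm{Re}(x)>0$, and are then continued analytically in all parameters to suitable domains of $\mathbb{C}$. The double alternating Hurwitz zeta function is $$\zeta_{E,2}(s,x,(1,\tau))=\sum_{m_1,m_2=0}^\infty\frac{(-1)^{m_1+m_2}}{(x+m_1+m_2\tau)^s}\qquad(\mathrm{Re}(s)>0),$$ continued analytically in $s$; it is holomorphic at $s=0$. The normalized double alternating gamma function is $$\bar\Gamma_2(x,(1,\tau))=\exp\left(\frac{\partial}{\partial s}\zeta_{E,2}(s,x,(1,\tau))\Big|_{s=0}\right),$$ and $$\mathcal C_2(x,(1,\tau))=\bar\Gamma_2(x,(1,\tau))^{-1}\,\bar\Gamma_2(1+\tau-x,(1,\tau)).$$ Special values are regarded as points of the projective line, so that $\infty$ (a pole) is allowed as a value.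
   Formalization: When some factors of the product are 0 and others ∞ (e.g. τ=1/2, m=3), the printed product is undefined; it is then read as the limit as ε→0 of the product with every k replaced by k+ε in the tangents. In all other cases the equality is literal in the projective line. *)

(* Defs.v *)
From Stdlib Require Export Reals List.
From Coquelicot Require Export Coquelicot.
Export ListNotations.

Open Scope R_scope.

(** ** The projective line *)

Inductive P1 : Type :=
  | P1_fin (z : C)
  | P1_inf.

Definition P1_inv (p : P1) : P1 :=
  match p with
  | P1_fin z => if Ceq_dec z 0 then P1_inf else P1_fin (/ z)
  | P1_inf => P1_fin 0
  end.

(* [None] stands for the indeterminate form 0 * oo. *)
Definition P1_mul (p q : P1) : option P1 :=
  match p, q with
  | P1_fin z, P1_fin w => Some (P1_fin (z * w))
  | P1_inf, P1_inf => Some P1_inf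
  | P1_fin z, P1_inf | P1_inf, P1_fin z =>
      if Ceq_dec z 0 then None else Some P1_inf
  end.

(* Indeterminacy propagates, so the result is [None] exactly when both 0 and oo
   occur in the list. *)
Definition P1_prod (l : list P1) : option P1 :=
  fold_right
    (fun p acc => match acc with Some q => P1_mul p q | None => None end)
    (Some (P1_fin 1)) l.

(* [P1_pow_sign p n] is p ^ ((-1) ^ n). *)
Definition P1_pow_sign (p : P1) (n : nat) : P1 :=
  if Nat.even n then p else P1_inv p.

Definition P1_tan (y : R) : P1 :=
  if Req_dec_T (cos y) 0 then P1_inf else P1_fin (RtoC (tan y)).

(* Convergence f e -> v in the projective line as e -> 0, e <> 0, read in the
   affine chart z around a finite v and in the chart 1 / z around oo; the values
   of f near 0 have to be determinate. *)
Definition P1_lim0 (f : R -> option P1) (v : P1) : Prop :=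
  match v with
  | P1_fin w =>
      exists g : R -> C,
        locally' 0 (fun e => f e = Some (P1_fin (g e))) /\
        filterlim g (locally' 0) (locally w)
  | P1_inf =>
      exists g : R -> C,
        locally' 0 (fun e => exists p, f e = Some p /\ P1_inv p = P1_fin (g e)) /\
        filterlim g (locally' 0) (locally (RtoC 0))
  end.

(* The value at e = 0 of an expression in P1: the expression itself when it is
   determinate, and its limit when it is an indeterminate form 0 * oo. *)
Definition P1_value_at0 (f : R -> option P1) (v : P1) : Prop :=
  f 0 = Some v \/ (f 0 = None /\ P1_lim0 f v).

(** ** Complex powers and analyticity *)

Definition Cexp (z : C) : C :=
  (exp (Re z) * cos (Im z), exp (Re z) * sin (Im z)).

(* Principal logarithm, only meant for the right half-plane 0 < Re z. *)
Definition Clog (z : C) : C := (ln (Cmod z), atan (Im z / Re z)).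

Definition Cpower (z s : C) : C := Cexp (s * Clog z).

Definition C_analytic_at (f : C -> C) (a : C) : Prop :=
  exists (c : nat -> C) (r : R), 0 < r /\
    forall z : C, Cmod (z - a) < r ->
      is_pseries (K := C_AbsRing) (V := C_NormedModule) c (z - a)%C (f z).

(* Meromorphic functions on C as analytic maps into the projective line: near
   each point either the function or its inverse is a finite analytic function. *)
Definition P1_meromorphic (G : C -> P1) : Prop :=
  forall a : C, exists (f : C -> C) (r : R), C_analytic_at f a /\ 0 < r /\
    ((forall z : C, Cmod (z - a) < r -> G z = P1_fin (f z)) \/
     (forall z : C, Cmod (z - a) < r -> P1_inv (G z) = P1_fin (f z))).

(** ** Double alternating zeta and gamma functions *)

Definition zeta_E2_term (tau : R) (x s : C) (m1 m2 : nat) : C :=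
  (RtoC ((-1) ^ (m1 + m2))
     / Cpower (x + RtoC (INR m1) + RtoC (INR m2) * RtoC tau) s)%C.

(* The double series converges only conditionally for small Re s; its sum is the
   limit of the rectangular partial sums, both sides growing independently. *)
Definition is_zeta_E2_series (tau : R) (x s l : C) : Prop :=
  filterlim
    (fun N : nat * nat =>
       sum_n (fun m1 => sum_n (fun m2 => zeta_E2_term tau x s m1 m2) (snd N))
         (fst N))
    (filter_prod eventually eventually) (locally l).

(* Z is s |-> zeta_{E,2}(s, x, (1, tau)), for 0 < Re x, continued analytically
   from 0 < Re s to a neighbourhood of s = 0.  A half-plane and a disc centred
   on its boundary have a connected union, so the germ of Z at 0 is unique. *)
Definition is_zeta_E2 (tau : R) (x : C) (Z : C -> C) : Prop :=
  (forall s : C, 0 < Re s -> is_zeta_E2_series tau x s (Z s)) /\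
  (forall s : C, 0 < Re s \/ s = RtoC 0 -> C_analytic_at Z s).

(* Gam is x |-> Gamma-bar_2(x, (1, tau)) on C: the exponential of the
   s-derivative of zeta_{E,2} at s = 0 for 0 < Re x, continued meromorphically.
   By the identity theorem at most one Gam qualifies. *)
Definition is_Gamma_bar2 (tau : R) (Gam : C -> P1) : Prop :=
  (forall x : C, 0 < Re x ->
     exists Z : C -> C, is_zeta_E2 tau x Z /\
       Gam x = P1_fin (Cexp (C_derive Z 0))) /\
  P1_meromorphic Gam.

(* Since 0 < tau, one of x and 1 + tau - x lies in the right half-plane, where
   Gamma-bar_2 is finite and non-zero; so this product is never indeterminate
   and is the value at x of the meromorphic function C_2. *)
Definition C2 (tau : R) (Gam : C -> P1) (x : C) : option P1 :=
  P1_mul (P1_inv (Gam x)) (Gam (RtoC 1 + RtoC tau - x)%C).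

(* Main.v *)
Require Import Defs.
From Stdlib Require Import Lra Lia Classical.

(** Summing the double series over one index at a time telescopes
    [zeta (s, x) + zeta (s, x + 1)] to the single alternating series with terms
    [(-1)^n (x + n tau)^(-s)], so its derivative at [s = 0] can be compared with that at
    [tau - x]: the difference is [sum (-1)^n ln ((n + 1 - u) / (n + u))], [u = x / tau],
    which is [- ln (tan (PI u / 2))] by the product formula for the cotangent.  This gives
    [C_2 (x) C_2 (x + 1) = tan (PI x / (2 tau))] for small [x > 0], hence for all [x > 0] by
    analytic continuation.  Summing over the other index gives
    [C_2 (x) C_2 (x + tau) = tan (PI x / 2)]; dividing the two and letting [x -> 0] yields
    [C_2 (1)^2 = 1 / tau], and [C_2 (1) > 0].  Iterating from [C_2 (1 + e)] and letting
    [e -> 0] in the projective line gives the value at [m], also when zeros and poles of the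
    tangent factors collide. *)

(** * The product formula for the cotangent *)

(** The obstacle is that the series identities are available only for [0 < s], whereas the gamma
    function is a derivative at [s = 0], about which analyticity gives differentiability but no
    formula. Order replaces termwise differentiation: for real [s > 0] the relevant combination of
    zeta values is an alternating series with decreasing terms, hence lies between consecutive
    partial sums; these are smooth at 0 and vanish there, so the inequalities pass to the
    derivatives. The monotonicity comes from [x < tau - x], whence the restriction to small [x] and
    the later continuation. The continuation runs along the real line only, because every argument
    of [Gam] that occurs is real. On the positive half-line [Gam] is moreover positive, which
    permits divisions and the choice of a square root; elsewhere it may have zeros and poles, so
    equality is expressed in homogeneous coordinates. The shift [e] makes all tangent factors finite
    and non-zero, so that the recursion in [m] can be solved by ordinary division. *)

Lemma ex_derive_continuous_R (f : R -> R) (x : R) : ex_derive f x -> continuous f x.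
Proof. apply (ex_derive_continuous (K := R_AbsRing) (V := R_NormedModule)). Qed.

(** Wallis integrals with an extra factor [cos (u * t)]. Up to rational factors the moments of order
    0 and 1 are the sine and the cosine of [u * (PI / 2)], so the tangent appears as a quotient of
    consecutive moments. *)
Definition cos_moment (u : R) (n : nat) : R :=
  RInt (fun t => cos (u * t) * cos t ^ n) 0 (PI / 2).

Lemma cos_moment_integrand_continuous (u : R) (n : nat) (t : R) :
  continuous (fun t => cos (u * t) * cos t ^ n) t.
Proof. apply ex_derive_continuous_R; auto_derive; auto. Qed.

Lemma ex_cos_moment (u : R) (n : nat) :
  ex_RInt (fun t => cos (u * t) * cos t ^ n) 0 (PI / 2).
Proof.
  apply (ex_RInt_continuous (V := R_CompleteNormedModule)); intros t _.
  apply cos_moment_integrand_continuous.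
Qed.

Lemma cos_moment_correct (u : R) (n : nat) :
  is_RInt (fun t => cos (u * t) * cos t ^ n) 0 (PI / 2) (cos_moment u n).
Proof. apply (RInt_correct (V := R_CompleteNormedModule)), ex_cos_moment. Qed.

(** Two integrations by parts, carried out at once through an explicit antiderivative. For [u = 0]
    this is the Wallis recursion. *)
Lemma cos_moment_rec (u : R) (n : nat) :
  ((INR n + 2) ^ 2 - u ^ 2) * cos_moment u (n + 2)
  = (INR n + 2) * (INR n + 1) * cos_moment u n.
Proof.
  (* [F] collects the boundary terms of the two integrations by parts; it vanishes at [PI / 2]
     because of the power of [cos t] and at 0 because of the two sines. *)
  pose (F := fun t => cos t ^ (n + 1) *
     ((INR n + 2) * cos (u * t) * sin t - u * sin (u * t) * cos t)).
  assert (H1 : is_RInt (fun t =>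
     ((INR n + 2) ^ 2 - u ^ 2) * (cos (u * t) * cos t ^ (n + 2)) -
     (INR n + 2) * (INR n + 1) * (cos (u * t) * cos t ^ n)) 0 (PI / 2)
     (F (PI / 2) - F 0)).
  { apply (is_RInt_derive F).
    - intros t _. unfold F. auto_derive; [auto|].
      replace (Init.Nat.pred (n + 1)) with n by lia.
      rewrite plus_INR, !pow_add. simpl INR.
      apply Rminus_diag_uniq.
      (* The derivative of [F] and the integrand agree only modulo the Pythagorean identity; this is
         the multiple of it by which they differ. *)
      transitivity (- ((INR n + 1) * (INR n + 2) * cos t ^ n * cos (u * t)) * ((sin t)² + (cos t)² - 1)).
      { unfold Rsqr; ring. }
      rewrite sin2_cos2; ring.
    - intros t _.
      apply ex_derive_continuous_R; auto_derive; auto. }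
  assert (H2 := is_RInt_minus _ _ _ _ _ _
    (is_RInt_scal _ _ _ ((INR n + 2) ^ 2 - u ^ 2) _ (cos_moment_correct u (n + 2)))
    (is_RInt_scal _ _ _ ((INR n + 2) * (INR n + 1)) _ (cos_moment_correct u n))).
  apply (is_RInt_unique (V := R_CompleteNormedModule)) in H1.
  apply (is_RInt_unique (V := R_CompleteNormedModule)) in H2.
  assert (H3 := eq_trans (eq_sym H1) H2). clear H1 H2.
  unfold F in H3. rewrite cos_PI2, (Rmult_0_r u), !sin_0, !pow_add, !pow_1 in H3.
  unfold minus, plus, opp, scal in H3; simpl in H3; unfold mult in H3; simpl in H3.
  lra.
Qed.

Lemma cos_moment_0 (u : R) : u * cos_moment u 0 = sin (u * (PI / 2)).
Proof.
  assert (H1 : is_RInt (fun t => u * (cos (u * t) * cos t ^ 0)) 0 (PI / 2)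
     (sin (u * (PI / 2)) - sin (u * 0))).
  { apply (is_RInt_derive (fun t => sin (u * t))).
    - intros t _. auto_derive; [auto|]. simpl; ring.
    - intros t _.
      apply ex_derive_continuous_R; auto_derive; auto. }
  assert (H2 := is_RInt_scal _ _ _ u _ (cos_moment_correct u 0)).
  apply (is_RInt_unique (V := R_CompleteNormedModule)) in H1.
  apply (is_RInt_unique (V := R_CompleteNormedModule)) in H2.
  assert (H3 := eq_trans (eq_sym H1) H2).
  rewrite Rmult_0_r, sin_0 in H3. unfold scal in H3; simpl in H3; unfold mult in H3; simpl in H3.
  lra.
Qed.

Lemma cos_moment_1 (u : R) : (1 - u ^ 2) * cos_moment u 1 = cos (u * (PI / 2)).
Proof.
  pose (F := fun t => cos (u * t) * sin t - u * sin (u * t) * cos t).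
  assert (H1 : is_RInt (fun t => (1 - u ^ 2) * (cos (u * t) * cos t ^ 1)) 0 (PI / 2)
     (F (PI / 2) - F 0)).
  { apply (is_RInt_derive F).
    - intros t _. unfold F. auto_derive; [auto|]. ring.
    - intros t _.
      apply ex_derive_continuous_R; auto_derive; auto. }
  assert (H2 := is_RInt_scal _ _ _ (1 - u ^ 2) _ (cos_moment_correct u 1)).
  apply (is_RInt_unique (V := R_CompleteNormedModule)) in H1.
  apply (is_RInt_unique (V := R_CompleteNormedModule)) in H2.
  assert (H3 := eq_trans (eq_sym H1) H2). unfold F in H3.
  rewrite Rmult_0_r, sin_0, cos_PI2, sin_PI2 in H3.
  unfold scal in H3; simpl in H3; unfold mult in H3; simpl in H3.
  lra.
Qed.

Lemma cos_moment_pos (u : R) (n : nat) : 0 < u < 1 -> 0 < cos_moment u n.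
Proof.
  intros Hu. pose proof PI_RGT_0.
  apply RInt_gt_0; [lra| |intros; apply cos_moment_integrand_continuous].
  intros t Ht. apply Rmult_lt_0_compat.
  - apply cos_gt_0; nra.
  - apply pow_lt, cos_gt_0; lra.
Qed.

(** Monotonicity in [n] is the other half of the Wallis argument: with the recursion it squeezes the
    quotient of consecutive moments to 1. *)
Lemma cos_moment_le (u : R) (n : nat) :
  0 < u < 1 -> cos_moment u (S n) <= cos_moment u n.
Proof.
  intros Hu. pose proof PI_RGT_0.
  apply RInt_le; [lra|apply ex_cos_moment|apply ex_cos_moment|].
  intros t Ht. apply Rmult_le_compat_l.
  - left; apply cos_gt_0; nra.
  - rewrite <- (Rmult_1_l (cos t ^ n)). simpl.
    apply Rmult_le_compat_r; [left; apply pow_lt, cos_gt_0; lra|].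
    apply COS_bound.
Qed.

(* The even partial products of the cotangent product, in closed form: the
   quotient of consecutive moments measures how far they are from the limit. *)
Lemma cot_alternating_sum (u : R) (N : nat) :
  0 < u < 1 ->
  sum_f_R0 (tg_alt (fun n => ln ((INR n + 1 - u) / (INR n + u)))) (S (2 * N))
  = - ln (tan (PI * u / 2))
    + ln (cos_moment u (2 * N) / cos_moment u (2 * N + 1)
          * ((2 * INR N + 1) / (2 * INR N + 2 - u))).
Proof.
  intros Hu. pose proof PI_RGT_0.
  assert (Hpos : forall n, 0 < cos_moment u n) by (intro; apply cos_moment_pos; auto).
  assert (Hs : 0 < sin (u * (PI / 2))) by (apply sin_gt_0; nra).
  assert (Hc : 0 < cos (u * (PI / 2))) by (apply cos_gt_0; nra).
  replace (PI * u / 2) with (u * (PI / 2)) by field.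
  unfold tan.
  assert (Ht : 0 < sin (u * (PI / 2)) / cos (u * (PI / 2))) by (apply Rdiv_lt_0_compat; auto).
  induction N as [|N IH].
  - simpl sum_f_R0. unfold tg_alt. simpl.
    pose proof (cos_moment_0 u) as E0. pose proof (cos_moment_1 u) as E1.
    assert (0 < 1 - u ^ 2) by nra.
    rewrite <- E0, <- E1.
    pose proof (Hpos 0%nat). pose proof (Hpos 1%nat).
    rewrite !Rmult_1_r, Rmult_1_l.
    rewrite <- ln_Rinv by (apply Rdiv_lt_0_compat; apply Rmult_lt_0_compat; lra).
    rewrite <- ln_mult.
    replace (-1 * ln ((1 + 1 - u) / (1 + u))) with (- ln ((1 + 1 - u) / (1 + u))) by ring.
    rewrite <- ln_Rinv by (apply Rdiv_lt_0_compat; lra).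
    rewrite <- ln_mult.
    f_equal. field; repeat split; try lra.
    1: apply Rdiv_lt_0_compat; lra.
    1: apply Rinv_0_lt_compat, Rdiv_lt_0_compat; lra.
    1: apply Rinv_0_lt_compat, Rdiv_lt_0_compat; apply Rmult_lt_0_compat; lra.
    apply Rmult_lt_0_compat; apply Rdiv_lt_0_compat; lra.
  - replace (S (2 * S N)) with (S (S (S (2 * N)))) by lia.
    rewrite tech5, tech5, IH. unfold tg_alt.
    pose proof (cos_moment_rec u (2 * N)) as Ea.
    pose proof (cos_moment_rec u (2 * N + 1)) as Eb.
    replace (2 * S N)%nat with (2 * N + 2)%nat by lia.
    replace (2 * N + 2 + 1)%nat with (2 * N + 1 + 2)%nat by lia.
    pose proof (Hpos (2 * N)%nat) as P0. pose proof (Hpos (2 * N + 1)%nat) as P1.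
    pose proof (Hpos (2 * N + 2)%nat) as P2. pose proof (Hpos (2 * N + 1 + 2)%nat) as P3.
    replace ((-1) ^ S (S (2 * N))) with 1
      by (replace (S (S (2 * N))) with (2 * (S N))%nat by lia; rewrite pow_1_even; auto).
    replace ((-1) ^ S (S (S (2 * N)))) with (-1)
      by (replace (S (S (S (2 * N)))) with (S (2 * (S N)))%nat by lia; rewrite pow_1_odd; auto).
    rewrite !S_INR in *. rewrite plus_INR, mult_INR in *. simpl INR in *.
    pose proof (pos_INR N). set (n := INR N) in *.
    set (a := cos_moment u (2 * N)) in *. set (b := cos_moment u (2 * N + 1)) in *.
    set (a' := cos_moment u (2 * N + 2)) in *. set (b' := cos_moment u (2 * N + 1 + 2)) in *.
    replace ((1 + 1) * n) with (2 * n) in * by ring.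
    (* Solving the recursion for the lower moments turns the two new logarithms into exactly the
       change of the correction term from [N] to [N + 1]. *)
    assert (Na : a = ((2 * n + 2) ^ 2 - u ^ 2) / ((2 * n + 2) * (2 * n + 1)) * a').
    { field_simplify_eq; lra. }
    assert (Nb : b = ((2 * n + 3) ^ 2 - u ^ 2) / ((2 * n + 3) * (2 * n + 2)) * b').
    { field_simplify_eq; lra. }
    rewrite Rplus_assoc, Rplus_assoc. f_equal.
    rewrite Rmult_1_l.
    match goal with |- context [-1 * ln ?x] => replace (-1 * ln x) with (- ln x) by ring end.
    assert (0 < a / b) by (apply Rdiv_lt_0_compat; lra).
    assert (0 < (2 * n + 1) / (2 * n + 2 - u)) by (apply Rdiv_lt_0_compat; lra).
    rewrite <- ln_Rinv by (apply Rdiv_lt_0_compat; lra).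
    rewrite <- ln_mult by (try apply Rinv_0_lt_compat; apply Rdiv_lt_0_compat; lra).
    rewrite <- ln_mult.
    2: apply Rmult_lt_0_compat; lra.
    2: apply Rmult_lt_0_compat; try apply Rinv_0_lt_compat; apply Rdiv_lt_0_compat; lra.
    f_equal. rewrite Na, Nb. field. repeat split; nra.
Qed.

(** The correction term of [cot_alternating_sum] tends to [ln 1]. Partial sums ending at an even
    index are recovered in [alt_zeta2_derive], by removing a last term that tends to 0. *)
Lemma cot_alternating_series (u : R) :
  0 < u < 1 ->
  is_lim_seq (fun N => sum_f_R0 (tg_alt (fun n => ln ((INR n + 1 - u) / (INR n + u)))) (S (2 * N)))
    (- ln (tan (PI * u / 2))).
Proof.
  intros Hu.
  apply (is_lim_seq_ext (fun N => - ln (tan (PI * u / 2))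
    + ln (cos_moment u (2 * N) / cos_moment u (2 * N + 1)
          * ((2 * INR N + 1) / (2 * INR N + 2 - u))))).
  { intro N; symmetry; apply cot_alternating_sum; auto. }
  replace (Finite (- ln (tan (PI * u / 2)))) with (Finite (- ln (tan (PI * u / 2)) + 0)) by (f_equal; ring).
  apply is_lim_seq_plus'; [apply is_lim_seq_const|].
  rewrite <- ln_1.
  apply (is_lim_seq_continuous ln); [apply continuity_pt_filterlim, continuous_ln; lra|].
  assert (Hinv : forall a c d : R, 0 < d -> (forall n : nat, 0 < INR n * d + c) ->
      is_lim_seq (fun n => (INR n * d + a) / (INR n * d + c)) 1).
  { intros a c d Hd Hc.
    apply (is_lim_seq_ext (fun n => 1 + (a - c) * / (INR n * d + c))).
    { intros n; specialize (Hc n); field; lra. }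
    replace (Finite 1) with (Rbar_plus 1 (Rbar_mult (a - c) 0)) by (simpl; f_equal; ring).
    apply is_lim_seq_plus with (1 : Rbar) (Rbar_mult (a - c) 0).
    - apply is_lim_seq_const.
    - apply is_lim_seq_scal_l.
      replace (Finite 0) with (Rbar_inv p_infty) by reflexivity.
      apply is_lim_seq_inv; [|discriminate].
      apply is_lim_seq_plus with p_infty c; [|apply is_lim_seq_const|reflexivity].
      apply (is_lim_seq_mult _ _ p_infty d); [apply is_lim_seq_INR|apply is_lim_seq_const|].
      apply is_Rbar_mult_p_infty_pos; exact Hd.
    - simpl. unfold is_Rbar_plus. simpl. reflexivity. }
  replace (Finite 1) with (Finite (1 * 1)) by (f_equal; ring).
  apply is_lim_seq_mult'.
  (* The upper bound is the quotient of the moments of order [2 * N] and [2 * N + 2], which the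
     recursion makes a rational function of [N]; the moment of order [2 * N + 1] lies between these
     two. *)
  - apply (is_lim_seq_le_le (fun _ => 1) _ (fun N => (INR N * 2 + (2 + u)) / (INR N * 2 + 2) *
        ((INR N * 2 + (2 - u)) / (INR N * 2 + 1)))).
    + intros N. pose proof (cos_moment_pos u (2 * N + 1) Hu). pose proof (cos_moment_pos u (2 * N + 2) Hu).
      pose proof (cos_moment_le u (2 * N) Hu) as L1.
      pose proof (cos_moment_le u (2 * N + 1) Hu) as L2.
      replace (S (2 * N)) with (2 * N + 1)%nat in L1 by lia.
      replace (S (2 * N + 1)) with (2 * N + 2)%nat in L2 by lia.
      pose proof (cos_moment_rec u (2 * N)) as E.
      rewrite mult_INR in E. simpl INR in E. pose proof (pos_INR N).
      split.
      * apply (Rmult_le_reg_r (cos_moment u (2 * N + 1))); [lra|].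
        unfold Rdiv. rewrite Rmult_assoc, Rinv_l by lra. lra.
      * apply (Rmult_le_reg_r (cos_moment u (2 * N + 1))); [lra|].
        unfold Rdiv at 1. rewrite Rmult_assoc, Rinv_l, Rmult_1_r by lra.
        replace (cos_moment u (2 * N)) with ((INR N * 2 + (2 + u)) / (INR N * 2 + 2) *
          ((INR N * 2 + (2 - u)) / (INR N * 2 + 1)) * cos_moment u (2 * N + 2)).
        2:{ field_simplify_eq; [|lra]. replace ((1+1) * INR N) with (2 * INR N) in E by ring. lra. }
        apply Rmult_le_compat_l; [|lra].
        apply Rmult_le_pos; apply Rlt_le, Rdiv_lt_0_compat; lra.
    + apply is_lim_seq_const.
    + replace (Finite 1) with (Finite (1 * 1)) by (f_equal; ring).
      apply is_lim_seq_mult'; apply Hinv; auto; try lra; intro n; pose proof (pos_INR n); lra.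
  - apply (is_lim_seq_ext (fun n => (INR n * 2 + 1) / (INR n * 2 + (2 - u)))).
    { intros n; pose proof (pos_INR n). field; lra. }
    apply Hinv; auto; try lra; intro n; pose proof (pos_INR n); lra.
Qed.

(** * The derivative of the double alternating zeta function at 0 *)

Definition alt_sum (b x s : R) (M : nat) : R :=
  sum_n (fun m => (-1) ^ m * Rpower (x + INR m * b) (- s)) M.

Definition alt_sum2 (a b x s : R) (N M : nat) : R :=
  sum_n (fun m1 => sum_n (fun m2 =>
    (-1) ^ (m1 + m2) * Rpower (x + INR m1 * a + INR m2 * b) (- s)) M) N.

(** Both periods are parameters, so that one lemma yields both reflection formulas, with the periods
    taken in either order. Only [0 < s] is constrained: what happens at 0 enters later through
    differentiability of [z]. *)
Definition alt_zeta2 (a b x : R) (z : R -> R) : Prop :=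
  forall s, 0 < s ->
    filterlim (fun N : nat * nat => alt_sum2 a b x s (fst N) (snd N))
      (filter_prod eventually eventually) (locally (z s)).

(** The convergence is only conditional, but it is along both indices independently, a notion
    symmetric in the two; the finite rectangular sums can then be transposed. *)
Lemma alt_zeta2_swap (a b x : R) (z : R -> R) :
  alt_zeta2 a b x z -> alt_zeta2 b a x z.
Proof.
  intros H s Hs P HP.
  destruct (H s Hs P HP) as [Q1 Q2 h1 h2 HQ].
  apply (Filter_prod _ _ _ Q2 Q1 h2 h1). intros n m Hn Hm. simpl.
  specialize (HQ m n Hm Hn). simpl in HQ. unfold alt_sum2 in *.
  rewrite sum_n_switch.
  erewrite sum_n_ext; [exact HQ|]. intros i; simpl.
  apply sum_n_ext; intros j.
  rewrite (Nat.add_comm j i). f_equal. f_equal. ring.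
Qed.

(** * Telescoping the double series for positive [s] *)

Lemma Rpower_neg_decr (s y z : R) : 0 <= s -> 0 < y <= z -> Rpower z (- s) <= Rpower y (- s).
Proof.
  intros Hs Hy. rewrite !Rpower_Ropp.
  apply Rinv_le_contravar; [apply exp_pos|apply Rle_Rpower_l; lra].
Qed.

Lemma Rpower_neg_lim (b x s : R) : 0 < b -> 0 < x -> 0 < s ->
  is_lim_seq (fun n => Rpower (x + INR n * b) (- s)) 0.
Proof.
  intros Hb Hx Hs. apply is_lim_seq_spec. intros eps.
  pose proof (is_lim_seq_INR) as HI. apply is_lim_seq_spec in HI.
  (* The threshold is [eps] to the power [-1 / s], the point where the power with exponent [- s]
     takes the value [eps]. *)
  destruct (HI (exp (- (ln eps / s)) / b)) as [N HN]. exists N. intros n Hn.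
  specialize (HN n Hn). simpl in HN. pose proof (pos_INR n).
  assert (0 <= INR n * b) by nra.
  rewrite Rminus_0_r, Rabs_pos_eq by (left; apply exp_pos).
  rewrite <- (exp_ln eps) by apply cond_pos. unfold Rpower. apply exp_increasing.
  assert (L : exp (- (ln eps / s)) < x + INR n * b).
  { apply (Rmult_lt_compat_r b) in HN; [|lra].
    unfold Rdiv in HN at 1. rewrite Rmult_assoc, Rinv_l, Rmult_1_r in HN by lra. lra. }
  apply ln_increasing in L; [|apply exp_pos]. rewrite ln_exp in L.
  apply (Rmult_lt_compat_r s) in L; [|lra].
  replace (- (ln eps / s) * s) with (- ln eps) in L by (field; lra). lra.
Qed.

(** Induction by peeling off the first term: the rest is minus the same kind of sum started at
    [x + b]. The bound does not depend on [M], which is what later allows a whole row of the double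
    sum to be discarded. *)
Lemma alt_sum_bound (b x s : R) (M : nat) : 0 < b -> 0 < x -> 0 <= s ->
  0 <= alt_sum b x s M <= Rpower x (- s).
Proof.
  intros Hb. revert x. induction M as [|M IH]; intros x Hx Hs; unfold alt_sum.
  - rewrite sum_O. simpl. replace (x + 0 * b) with x by ring.
    pose proof (exp_pos (- s * ln x)). unfold Rpower. lra.
  - unfold sum_n. rewrite sum_Sn_m by lia.
    rewrite <- sum_n_m_S.
    destruct (IH (x + b)) as [I1 I2]; [lra|lra|].
    unfold alt_sum, sum_n in I1, I2.
    rewrite (sum_n_m_ext _ (fun n => scal (-1) ((-1) ^ n * Rpower (x + b + INR n * b) (- s)))).
    2:{ intros n. rewrite S_INR. unfold scal; simpl; unfold mult; simpl.
        replace (x + (INR n + 1) * b) with (x + b + INR n * b) by ring. ring. }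
    rewrite sum_n_m_scal_l. unfold scal, plus; simpl; unfold mult; simpl.
    replace (x + 0 * b) with x by ring.
    assert (Rpower (x + b) (- s) <= Rpower x (- s)) by (apply Rpower_neg_decr; lra).
    match goal with |- 0 <= _ + -1 * ?B <= _ =>
      match type of I1 with _ <= ?A => change B with A end end.
    lra.
Qed.

(** Shifting [x] by [a] moves each row to the next one with the opposite sign, so only row 0 and row
    [N + 1] survive. *)
Lemma alt_sum2_telescope (a b x s : R) (N M : nat) :
  alt_sum2 a b x s N M + alt_sum2 a b (x + a) s N M
  = alt_sum b x s M + (-1) ^ N * alt_sum b (x + INR (S N) * a) s M.
Proof.
  assert (E : forall k y, sum_n (fun m2 => (-1) ^ (k + m2) *
     Rpower (y + INR m2 * b) (- s)) M = (-1) ^ k * alt_sum b y s M).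
  { intros k y. unfold alt_sum.
    rewrite <- (sum_n_scal_l (K := R_AbsRing) (V := R_ModuleSpace)).
    apply sum_n_ext; intros n. rewrite pow_add. unfold scal; simpl; unfold mult; simpl. ring. }
  unfold alt_sum2.
  induction N as [|N IH].
  - rewrite !sum_O, !E. simpl. rewrite Rmult_0_l, !Rplus_0_r, !Rmult_1_l. reflexivity.
  - rewrite !sum_Sn, !E. unfold plus; simpl plus.
    set (A := sum_n _ N) in *. set (B := sum_n _ N) in *.
    rewrite !S_INR in *.
    replace (x + a + (INR N + 1) * a) with (x + (INR N + 1 + 1) * a) by ring.
    simpl. simpl in IH. lra.
Qed.

Lemma alt_sum_cv (a b x s l1 l2 : R) :
  0 < a -> 0 < b -> 0 < x -> 0 < s ->
  filterlim (fun N : nat * nat => alt_sum2 a b x s (fst N) (snd N))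
      (filter_prod eventually eventually) (locally l1) ->
  filterlim (fun N : nat * nat => alt_sum2 a b (x + a) s (fst N) (snd N))
      (filter_prod eventually eventually) (locally l2) ->
  is_lim_seq (alt_sum b x s) (l1 + l2).
Proof.
  intros Ha Hb Hx Hs H1 H2. apply is_lim_seq_spec. intros eps.
  pose (e3 := mkposreal (eps / 3) ltac:(destruct eps; simpl; lra)).
  destruct (proj1 (filterlim_locally _ _) H1 e3) as [P1 P2 [n1 h1] [m1 k1] HP].
  destruct (proj1 (filterlim_locally _ _) H2 e3) as [Q1 Q2 [n2 h2] [m2 k2] HQ].
  pose proof (Rpower_neg_lim a x s Ha Hx Hs) as HL. apply is_lim_seq_spec in HL.
  destruct (HL e3) as [n3 h3].
  exists (m1 + m2)%nat. intros M HM.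
  (* This [N] depends on [eps] only and serves all large [M] at once, because the last row is
     bounded uniformly in [M]. *)
  pose (N := (n1 + n2 + n3)%nat).
  assert (A1 := HP N M (h1 N ltac:(unfold N; lia)) (k1 M ltac:(lia))).
  assert (A2 := HQ N M (h2 N ltac:(unfold N; lia)) (k2 M ltac:(lia))).
  assert (A3 := h3 (S N) ltac:(unfold N; lia)).
  unfold ball in A1, A2; simpl in A1, A2; unfold AbsRing_ball, abs, minus, plus, opp in A1, A2; simpl in A1, A2.
  pose proof (alt_sum2_telescope a b x s N M) as E.
  assert (0 <= INR (S N) * a) by (pose proof (pos_INR (S N)); nra).
  pose proof (alt_sum_bound b (x + INR (S N) * a) s M Hb ltac:(lra) ltac:(lra)) as B.
  rewrite Rminus_0_r in A3. apply Rabs_def2 in A1, A2, A3. simpl in A3.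
  assert (C : Rabs ((-1) ^ N * alt_sum b (x + INR (S N) * a) s M) < eps / 3).
  { rewrite Rabs_mult, pow_1_abs, Rmult_1_l, Rabs_pos_eq; simpl in *; lra. }
  apply Rabs_def2 in C. apply Rabs_def1; lra.
Qed.

(** Inequalities between the zeta function and its partial sums are known only to the right of 0;
    this lemma and the next carry them to the derivative and to the value at 0. *)
Lemma derive_le_right (f g : R -> R) (df dg : R) :
  is_derive f 0 df -> is_derive g 0 dg -> f 0 = g 0 ->
  (forall s, 0 < s -> f s <= g s) -> df <= dg.
Proof.
  intros Hf Hg E H. apply Rnot_lt_le. intros L.
  assert (D := is_derive_minus g f 0 dg df Hg Hf).
  apply is_derive_Reals in D. unfold minus, plus, opp in D; simpl in D.
  destruct (D ((df - dg) / 2) ltac:(lra)) as [d Hd].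
  destruct d as [d d0]; simpl in Hd.
  specialize (Hd (d / 2) ltac:(lra)). rewrite Rabs_pos_eq in Hd by lra.
  specialize (Hd ltac:(lra)). rewrite Rplus_0_l in Hd.
  specialize (H (d / 2) ltac:(lra)).
  apply Rabs_def2 in Hd. destruct Hd as [Hd _].
  assert (0 <= (g (d / 2) + - f (d / 2) - (g 0 + - f 0)) / (d / 2)).
  { apply Rmult_le_pos; [lra|]. left; apply Rinv_0_lt_compat; lra. }
  lra.
Qed.

Lemma continuous_le_right (f g : R -> R) :
  continuous f 0 -> continuous g 0 ->
  (forall s, 0 < s -> f s <= g s) -> f 0 <= g 0.
Proof.
  intros Hf Hg H.
  change (Rbar_le (f 0) (g 0)). apply (filterlim_le (F := at_right 0) f g).
  - exists (mkposreal 1 Rlt_0_1). intros y _ Hy. apply H; exact Hy.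
  - eapply filterlim_filter_le_1; [|exact Hf]. intros P HP. unfold at_right, within.
    eapply filter_imp; [|exact HP]. auto.
  - eapply filterlim_filter_le_1; [|exact Hg]. intros P HP. unfold at_right, within.
    eapply filter_imp; [|exact HP]. auto.
Qed.

(** Convexity of the power with exponent [- s]: the increment over a step [d] shrinks as [y] grows,
    by the mean value theorem. It supplies the monotonicity in the Leibniz criterion. *)
Lemma Rpower_neg_diff_decr (s d y z : R) : 0 < s -> 0 <= d -> 0 < y <= z ->
  Rpower z (- s) - Rpower (z + d) (- s) <= Rpower y (- s) - Rpower (y + d) (- s).
Proof.
  intros Hs Hd Hy.
  destruct (MVT_gen (fun y => exp (- s * ln y) - exp (- s * ln (y + d))) y z
    (fun y => - s * (/ y * exp (- s * ln y) - / (y + d) * exp (- s * ln (y + d))))) as [c [Hc Ec]].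
  - intros c Hc. rewrite Rmin_left, Rmax_right in Hc by lra.
    auto_derive; [lra|]. ring.
  - intros c Hc. rewrite Rmin_left, Rmax_right in Hc by lra.
    apply continuity_pt_filterlim.
    apply (ex_derive_continuous_R
      (fun y => exp (- s * ln y) - exp (- s * ln (y + d)))). auto_derive; lra.
  - rewrite Rmin_left, Rmax_right in Hc by lra. unfold Rpower.
    pose proof (Rpower_neg_decr s c (c + d) ltac:(lra) ltac:(lra)) as I1. unfold Rpower in I1.
    assert (I2 : / (c + d) <= / c) by (apply Rinv_le_contravar; lra).
    assert (0 < / (c + d)) by (apply Rinv_0_lt_compat; lra).
    pose proof (exp_pos (- s * ln (c + d))).
    assert (/ (c + d) * exp (- s * ln (c + d)) <= / c * exp (- s * ln c))
      by (apply Rmult_le_compat; lra).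
    assert (0 <= s * (/ c * exp (- s * ln c) - / (c + d) * exp (- s * ln (c + d))) * (z - y))
      by (apply Rmult_le_pos; [apply Rmult_le_pos|]; lra).
    lra.
Qed.

Lemma alt_sum_sum_f (b x y s : R) (M : nat) :
  alt_sum b x s M - alt_sum b y s M
  = sum_f_R0 (tg_alt (fun n => Rpower (x + INR n * b) (- s) - Rpower (y + INR n * b) (- s))) M.
Proof.
  unfold alt_sum. rewrite <- !sum_n_Reals.
  induction M as [|M IH].
  - rewrite !sum_O. unfold tg_alt. simpl; ring.
  - rewrite !sum_Sn, <- IH. unfold plus; simpl. unfold tg_alt. simpl. ring.
Qed.

(** For [0 < s] the combination [W] of the four functions is an alternating series with terms
    decreasing to 0, so it lies between consecutive partial sums [S_]. Their derivatives at 0 are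
    the partial sums [S'] of the logarithmic cotangent series, and both bounds converge to the same
    limit. *)
Lemma alt_zeta2_derive (a b x d1 d2 d3 d4 : R) (z1 z2 z3 z4 : R -> R) :
  0 < a -> 0 < b -> 0 < x < b / 2 ->
  alt_zeta2 a b x z1 -> alt_zeta2 a b (x + a) z2 ->
  alt_zeta2 a b (b - x) z3 -> alt_zeta2 a b (b - x + a) z4 ->
  is_derive z1 0 d1 -> is_derive z2 0 d2 -> is_derive z3 0 d3 -> is_derive z4 0 d4 ->
  d1 + d2 - (d3 + d4) = - ln (tan (PI * (x / b) / 2)).
Proof.
  intros Ha Hb Hx Z1 Z2 Z3 Z4 D1 D2 D3 D4.
  pose (u := x / b). fold u.
  assert (Ex : x = u * b) by (unfold u; field; lra).
  assert (Hu : 0 < u < / 2) by (split; nra).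
  pose (W := fun s => z1 s + z2 s - (z3 s + z4 s)).
  pose (S_ := fun n s => sum_f_R0 (tg_alt (fun n => Rpower (x + INR n * b) (- s)
      - Rpower (b - x + INR n * b) (- s))) n).
  pose (S' := fun n => sum_f_R0 (tg_alt (fun n => ln ((INR n + 1 - u) / (INR n + u)))) n).
  assert (Hnb : forall n, 0 <= INR n * b) by (intro n; pose proof (pos_INR n); nra).
  assert (DW : is_derive W 0 (d1 + d2 - (d3 + d4))).
  { unfold W. apply (is_derive_minus (fun s => z1 s + z2 s) (fun s => z3 s + z4 s) 0);
    [apply (is_derive_plus z1 z2)|apply (is_derive_plus z3 z4)]; auto. }
  assert (DS : forall n, is_derive (S_ n) 0 (S' n)).
  { assert (DT : forall n, is_derive (fun s => tg_alt (fun n => Rpower (x + INR n * b) (- s)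
      - Rpower (b - x + INR n * b) (- s)) n) 0
      (tg_alt (fun n => ln ((INR n + 1 - u) / (INR n + u))) n)).
    { intros n. unfold tg_alt, Rpower. pose proof (pos_INR n).
      auto_derive; [auto|]. rewrite !Ropp_0, !Rmult_0_l, exp_0.
      assert (E : (INR n + 1 - u) / (INR n + u) = (b - x + INR n * b) / (x + INR n * b)).
      { rewrite Ex. field. split; [nra|lra]. }
      rewrite E, ln_div by (specialize (Hnb n); lra). ring. }
    intros n. unfold S_, S'. induction n as [|n IH].
    - simpl. apply DT.
    - simpl. apply (is_derive_plus (fun s => S_ n s)); [apply IH|apply DT]. }
  assert (S0 : forall n, S_ n 0 = 0).
  { intros n. unfold S_. rewrite <- sum_n_Reals.
    rewrite (sum_n_ext _ (fun _ => 0)).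
    - rewrite sum_n_const. apply Rmult_0_r.
    - intros k. unfold tg_alt, Rpower. rewrite Ropp_0, !Rmult_0_l, Rminus_diag. apply Rmult_0_r. }
  assert (B : forall N s, 0 < s -> S_ (S (2 * N)) s <= W s <= S_ (2 * N)%nat s).
  { intros N s Hs. apply alternated_series_ineq.
    - intros n.
      (* Within each term the two bases differ by [b - 2 * x], which is positive because
         [x < b / 2]. *)
      pose proof (Rpower_neg_diff_decr s (b - 2 * x) (x + INR n * b) (x + INR (S n) * b) Hs ltac:(lra)) as R.
      rewrite S_INR in R at 1. specialize (Hnb n). specialize (R ltac:(lra)).
      replace (x + INR (S n) * b + (b - 2 * x)) with (b - x + INR (S n) * b) in R by ring.
      replace (x + INR n * b + (b - 2 * x)) with (b - x + INR n * b) in R by ring.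
      exact R.
    - apply is_lim_seq_Reals. replace 0 with (0 - 0) by ring.
      apply is_lim_seq_minus'; apply Rpower_neg_lim; lra.
    - apply is_lim_seq_Reals.
      apply (is_lim_seq_ext (fun M => alt_sum b x s M - alt_sum b (b - x) s M)).
      { intros M; apply alt_sum_sum_f. }
      unfold W. apply is_lim_seq_minus'.
      + apply (alt_sum_cv a); auto; lra.
      + apply (alt_sum_cv a); auto; lra. }
  assert (CW : continuous W 0)
    by (apply ex_derive_continuous_R; eexists; exact DW).
  assert (CS : forall n, continuous (S_ n) 0)
    by (intro n; apply ex_derive_continuous_R; eexists; apply DS).
  (* Comparing derivatives requires equal values at 0, and nothing is assumed about [W] there;
     continuity from the right supplies the value. *)
  assert (W0 : W 0 = 0).
  { assert (L1 : W 0 <= S_ (2 * 0)%nat 0)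
      by (apply continuous_le_right; auto; intros; apply B; auto).
    assert (L2 : S_ (S (2 * 0)) 0 <= W 0)
      by (apply continuous_le_right; auto; intros; apply B; auto).
    rewrite S0 in L1, L2. lra. }
  assert (B' : forall N, S' (S (2 * N)) <= d1 + d2 - (d3 + d4) <= S' (2 * N)%nat).
  { intros N. split.
    - apply (derive_le_right (S_ (S (2 * N))) W); auto; [rewrite S0; auto|intros s Hs; apply B; auto].
    - apply (derive_le_right W (S_ (2 * N)%nat)); auto; [rewrite S0; auto|intros; apply B; auto]. }
  pose proof (cot_alternating_series u ltac:(lra)) as L.
  assert (L2 : is_lim_seq (fun N => S' (2 * N)%nat) (- ln (tan (PI * u / 2)))).
  (* The even partial sum is the odd one with its last term removed; that term is the logarithm of a
     quotient written as 1 plus a null sequence. *)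
  { apply (is_lim_seq_ext (fun N => S' (S (2 * N)) +
       ln (1 + (1 - 2 * u) * / (INR (2 * N + 1) + u)))).
    { intros N. unfold S'. simpl sum_f_R0 at 1. unfold tg_alt at 2.
      replace (N + (N + 0))%nat with (2 * N)%nat by lia.
      rewrite pow_1_odd. replace (2 * N + 1)%nat with (S (2 * N)) by lia.
      pose proof (pos_INR (S (2 * N))).
      replace (1 + (1 - 2 * u) * / (INR (S (2 * N)) + u)) with
        ((INR (S (2 * N)) + 1 - u) / (INR (S (2 * N)) + u)) by (field; lra).
      ring. }
    replace (Finite (- ln (tan (PI * u / 2)))) with (Finite (- ln (tan (PI * u / 2)) + ln (1 + (1 - 2 * u) * 0))).
    2:{ f_equal. rewrite Rmult_0_r, Rplus_0_r, ln_1. ring. }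
    apply is_lim_seq_plus'; [exact L|].
    apply (is_lim_seq_continuous ln); [apply continuity_pt_filterlim, continuous_ln; lra|].
    apply is_lim_seq_plus'; [apply is_lim_seq_const|].
    apply is_lim_seq_mult'; [apply is_lim_seq_const|].
    replace (Finite 0) with (Rbar_inv p_infty) by reflexivity.
    apply is_lim_seq_inv; [|discriminate].
    apply is_lim_seq_plus with p_infty u; [|apply is_lim_seq_const|reflexivity].
    apply (is_lim_seq_subseq INR p_infty (fun N => 2 * N + 1)%nat); [|apply is_lim_seq_INR].
    apply eventually_subseq. intros n; lia. }
  pose proof (is_lim_seq_le_le _ (fun _ => d1 + d2 - (d3 + d4)) _ _ B' L L2) as LL.
  apply is_lim_seq_unique in LL. rewrite Lim_seq_const in LL. injection LL; auto.
Qed.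

(** * Real-analytic functions *)

Definition real_analytic (f : R -> R) (a : R) : Prop :=
  exists (c : nat -> R) (r : R), 0 < r /\
    forall t, Rabs (t - a) < r -> is_pseries c (t - a) (f t).

Lemma is_pseries_CV_radius (c : nat -> R) (y l t : R) :
  is_pseries c y l -> Rabs t < Rabs y -> Rbar_lt (Rabs t) (CV_radius c).
Proof.
  intros H Ht. apply Rbar_lt_le_trans with (Finite (Rabs y)); [exact Ht|].
  apply Rbar_not_lt_le. intros L. apply (CV_disk_outside c y L).
  apply ex_series_lim_0. exists l. apply is_pseries_R; exact H.
Qed.

(** Halving the radius puts every point considered strictly inside the disc of convergence, as
    Cauchy products and termwise differentiation demand. *)
Lemma real_analytic_radius (f : R -> R) (a : R) :
  real_analytic f a -> exists (c : nat -> R) (r : R), 0 < r /\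
    forall t, Rabs (t - a) < r ->
      is_pseries c (t - a) (f t) /\ Rbar_lt (Rabs (t - a)) (CV_radius c).
Proof.
  intros [c [r [Hr H]]]. exists c, (r / 2). split; [lra|]. intros t Ht.
  split; [apply H; lra|].
  apply (is_pseries_CV_radius c (a + r / 2 - a) (f (a + r / 2))).
  - apply H. replace (a + r / 2 - a) with (r / 2) by ring. rewrite Rabs_pos_eq; lra.
  - replace (a + r / 2 - a) with (r / 2) by ring. rewrite (Rabs_pos_eq (r / 2)); lra.
Qed.

Lemma real_analytic_plus (f g : R -> R) (a : R) :
  real_analytic f a -> real_analytic g a ->
  real_analytic (fun t => f t + g t) a.
Proof.
  intros [c [r [Hr H]]] [d [q [Hq K]]]. exists (PS_plus c d), (Rmin r q).
  split; [apply Rmin_pos; auto|]. intros t Ht.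
  apply (is_pseries_plus (V := R_NormedModule));
    [apply H|apply K]; eapply Rlt_le_trans; eauto; [apply Rmin_l|apply Rmin_r].
Qed.

Lemma real_analytic_minus (f g : R -> R) (a : R) :
  real_analytic f a -> real_analytic g a ->
  real_analytic (fun t => f t - g t) a.
Proof.
  intros [c [r [Hr H]]] [d [q [Hq K]]]. exists (PS_minus c d), (Rmin r q).
  split; [apply Rmin_pos; auto|]. intros t Ht.
  apply (is_pseries_minus (V := R_NormedModule));
    [apply H|apply K]; eapply Rlt_le_trans; eauto; [apply Rmin_l|apply Rmin_r].
Qed.

Lemma real_analytic_mult (f g : R -> R) (a : R) :
  real_analytic f a -> real_analytic g a ->
  real_analytic (fun t => f t * g t) a.
Proof.
  intros Hf Hg.
  destruct (real_analytic_radius f a Hf) as [c [r [Hr H]]].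
  destruct (real_analytic_radius g a Hg) as [d [q [Hq K]]].
  exists (PS_mult c d), (Rmin r q).
  split; [apply Rmin_pos; auto|]. intros t Ht.
  destruct (H t) as [H1 H2]; [eapply Rlt_le_trans; [exact Ht|apply Rmin_l]|].
  destruct (K t) as [K1 K2]; [eapply Rlt_le_trans; [exact Ht|apply Rmin_r]|].
  apply is_pseries_mult; auto.
Qed.

Lemma real_analytic_affine (f : R -> R) (k b a : R) :
  real_analytic f (k * a + b) -> real_analytic (fun t => f (k * t + b)) a.
Proof.
  intros [c [r [Hr H]]].
  (* The added 1 keeps the radius meaningful for [k = 0]. *)
  exists (fun n => c n * k ^ n), (r / (Rabs k + 1)).
  pose proof (Rabs_pos k).
  split; [apply Rdiv_lt_0_compat; lra|]. intros t Ht.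
  assert (B : Rabs (k * t + b - (k * a + b)) < r).
  { replace (k * t + b - (k * a + b)) with (k * (t - a)) by ring. rewrite Rabs_mult.
    apply (Rmult_lt_compat_l (Rabs k + 1)) in Ht; [|lra].
    replace ((Rabs k + 1) * (r / (Rabs k + 1))) with r in Ht by (field; lra).
    pose proof (Rabs_pos (t - a)). nra. }
  apply H in B. apply is_pseries_R. apply is_pseries_R in B.
  eapply is_series_ext; [|exact B]. intros n. simpl.
  replace (k * t + b - (k * a + b)) with (k * (t - a)) by ring.
  rewrite Rpow_mult_distr. ring.
Qed.

Lemma Derive_n_sin_shift (b : R) (n : nat) (t : R) :
  Derive_n (fun t => sin (t + b)) n t = sin (t + b + INR n * (PI / 2)).
Proof.
  revert t; induction n as [|n IH]; intros t.
  - simpl. f_equal; ring.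
  - change (Derive (Derive_n (fun t => sin (t + b)) n) t = sin (t + b + INR (S n) * (PI / 2))).
    rewrite (Derive_ext _ _ _ IH). apply is_derive_unique. auto_derive; [auto|].
    rewrite S_INR. replace (t + b + (INR n + 1) * (PI / 2)) with (PI / 2 + (t + b + INR n * (PI / 2))) by ring.
    rewrite <- cos_sin. ring.
Qed.

Lemma real_analytic_sin (a : R) : real_analytic sin a.
Proof.
  exists (fun n => Derive_n (fun t => sin (t + a)) n 0 / INR (Factorial.fact n)), 1.
  split; [lra|]. intros t _. replace (sin t) with (sin (t - a + a)) by (f_equal; ring).
  (* Every derivative of a sine is a shifted sine, hence bounded by 1, so the Taylor series
     converges to the function everywhere. *)
  apply (mk_pseries (fun t => sin (t + a)) 1 p_infty); [|reflexivity].
  intros n x _. rewrite Derive_n_sin_shift. split.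
  - destruct n as [|n]; [exact I|].
    apply (ex_derive_ext (fun t => sin (t + a + INR n * (PI / 2)))).
    + intros y; symmetry; apply Derive_n_sin_shift.
    + auto_derive; auto.
  - apply Rabs_le. apply SIN_bound.
Qed.

Lemma real_analytic_sin_affine (k b a : R) : real_analytic (fun t => sin (k * t + b)) a.
Proof. apply (real_analytic_affine sin), real_analytic_sin. Qed.

Lemma real_analytic_ext (f g : R -> R) (a : R) :
  (forall t, f t = g t) -> real_analytic f a -> real_analytic g a.
Proof.
  intros E [c [r [Hr H]]]. exists c, r. split; [auto|]. intros t Ht.
  rewrite <- E. auto.
Qed.

Lemma real_analytic_ex_derive (f : R -> R) (a : R) : real_analytic f a -> ex_derive f a.
Proof.
  intros Hf. destruct (real_analytic_radius f a Hf) as [c [r [Hr H]]].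
  apply (ex_derive_ext_loc (fun t => PSeries c (t - a))).
  - exists (mkposreal r Hr). intros t Ht. apply is_pseries_unique, H, Ht.
  - apply (ex_derive_comp (PSeries c) (fun t => t - a)).
    + exists (PSeries (PS_derive c) (a - a)). apply is_derive_PSeries, H.
      rewrite Rminus_diag, Rabs_R0; auto.
    + auto_derive; auto.
Qed.

Lemma real_analytic_const (k a : R) : real_analytic (fun _ => k) a.
Proof.
  (* A constant is a multiple of a sine of frequency 0 and phase [PI / 2]. *)
  apply (real_analytic_ext (fun t => k * sin (0 * t + PI / 2))).
  { intros t. rewrite Rmult_0_l, Rplus_0_l, sin_PI2. ring. }
  destruct (real_analytic_sin_affine 0 (PI / 2) a) as [c [r [Hr H]]].
  exists (PS_scal k c), r. split; [auto|]. intros t Ht.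
  apply (is_pseries_scal (V := R_NormedModule) k); [apply Rmult_comm|auto].
Qed.

(** * The identity theorem on the real line *)

Lemma pseries_zero_left_0 (c : nat -> R) (d : R) :
  0 < d -> (forall t, - d < t < 0 -> is_pseries c t 0) -> c 0%nat = 0.
Proof.
  intros Hd H.
  assert (HR : Rbar_lt (Rabs 0) (CV_radius c)).
  { apply (is_pseries_CV_radius c (- (d / 2)) 0); [apply H; lra|].
    rewrite Rabs_R0, Rabs_Ropp, Rabs_pos_eq; lra. }
  apply PSeries_continuity, continuity_pt_filterlim in HR.
  rewrite PSeries_0 in HR.
  assert (L : filterlim (PSeries c) (at_left 0) (locally (c 0%nat))).
  { eapply filterlim_filter_le_1; [|exact HR]. intros P HP.
    unfold at_left, within. eapply filter_imp; [|exact HP]. auto. }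
  assert (L0 : filterlim (PSeries c) (at_left 0) (locally 0)).
  { apply (filterlim_ext_loc (fun _ => 0)); [|apply filterlim_const].
    exists (mkposreal d Hd). intros y Hy Hy0. symmetry. apply is_pseries_unique, H.
    unfold ball in Hy; simpl in Hy; unfold AbsRing_ball, abs, minus, plus, opp in Hy; simpl in Hy.
    apply Rabs_def2 in Hy. lra. }
  apply (filterlim_locally_unique (F := at_left 0) _ _ _ L L0).
Qed.

(** Once the constant coefficient is known to vanish, dividing by [t] shifts the coefficients down;
    [t] is non-zero on the left interval. One side suffices, and one side is all that is known at
    the end of an interval. *)
Lemma pseries_zero_left (c : nat -> R) (d : R) :
  0 < d -> (forall t, - d < t < 0 -> is_pseries c t 0) -> forall n, c n = 0.
Proof.
  intros Hd H n. revert c H. induction n as [|n IH]; intros c H.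
  - apply (pseries_zero_left_0 c d); auto.
  - apply (IH (PS_decr_1 c)). intros t Ht.
    assert (E := is_pseries_decr_1 c t (/ t) 0).
    rewrite (pseries_zero_left_0 c d Hd H) in E.
    replace (0 : R) with (scal (/ t) (plus 0 (opp 0)) : R).
    + apply E; [|apply H; auto]. apply Rinv_l; lra.
    + unfold scal, plus, opp; simpl; unfold mult; simpl. ring.
Qed.

Lemma real_analytic_zero_left (h : R -> R) (b d : R) :
  real_analytic h b -> 0 < d -> (forall x, b - d < x < b -> h x = 0) ->
  locally b (fun x => h x = 0).
Proof.
  intros [c [r [Hr H]]] Hd Z.
  assert (C : forall n, c n = 0).
  { apply (pseries_zero_left c (Rmin r d)); [apply Rmin_pos; auto|]. intros t Ht.
    pose proof (Rmin_l r d). pose proof (Rmin_r r d).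
    rewrite <- (Z (b + t)) by lra. replace t with (b + t - b) at 1 by ring.
    apply H. replace (b + t - b) with t by ring. rewrite Rabs_left; lra. }
  exists (mkposreal r Hr). intros x Hx.
  rewrite <- (is_pseries_unique _ _ _ (H x Hx)). unfold PSeries.
  rewrite (Series_ext _ (fun n => 0 * 0)) by (intro n; rewrite C; ring).
  rewrite Series_scal_l; ring.
Qed.

(** At the supremum [b] of the points up to which [P] holds, the local function [h] vanishes to the
    left of [b], hence around [b], and [P] extends past [b]. A predicate is continued rather than an
    equation because the analytic function expressing it may change from point to point. *)
Lemma analytic_continuation (P : R -> Prop) (a0 a1 : R) :
  a0 < a1 -> (forall x, a0 < x < a1 -> P x) ->
  (forall b, exists h, real_analytic h b /\ locally b (fun x => P x <-> h x = 0)) ->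
  forall x, a0 < x -> P x.
Proof.
  intros Ha H1 HP x Hx. apply NNPP. intros Nx.
  pose (E := fun y => forall z, a0 < z < y -> P z).
  destruct (completeness E) as [b [Hb1 Hb2]].
  - exists x. intros y Hy. apply Rnot_lt_le. intros L. apply Nx, Hy; lra.
  - exists a1. exact H1.
  - assert (Hab : a1 <= b) by (apply Hb1; exact H1).
    assert (HPb : forall z, a0 < z < b -> P z).
    { intros z Hz. apply NNPP. intros Nz.
      assert (b <= z); [|lra]. apply Hb2. intros y Hy. apply Rnot_lt_le. intros L.
      apply Nz, Hy; lra. }
    destruct (HP b) as [h [Ah Lh]].
    destruct Lh as [e He].
    assert (Z : locally b (fun x => h x = 0)).
    { apply (real_analytic_zero_left h b (Rmin e (b - a0))); [auto|apply Rmin_pos; [apply cond_pos|lra]|].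
      intros z Hz. pose proof (Rmin_l e (b - a0)). pose proof (Rmin_r e (b - a0)).
      apply He; [|apply HPb; lra].
      unfold ball; simpl; unfold AbsRing_ball, abs, minus, plus, opp; simpl.
      rewrite Rabs_left; lra. }
    destruct Z as [e' Z].
    pose proof (cond_pos e). pose proof (cond_pos e').
    pose (m := Rmin e e'). assert (0 < m) by (apply Rmin_pos; auto).
    pose proof (Rmin_l e e' : m <= e). pose proof (Rmin_r e e' : m <= e').
    assert (b + m / 2 <= b); [|lra]. apply Hb1. intros z Hz.
    destruct (Rlt_dec z b); [apply HPb; lra|].
    assert (Bz : Rabs (z - b) < m) by (rewrite Rabs_pos_eq; lra).
    apply He; [|apply Z];
    unfold ball; simpl; unfold AbsRing_ball, abs, minus, plus, opp; simpl; unfold Rminus in Bz; lra.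
Qed.

(** * Restriction to the real line *)

Definition curve_analytic (f : R -> C) (a : R) : Prop :=
  real_analytic (fun t => Re (f t)) a /\ real_analytic (fun t => Im (f t)) a.

Lemma curve_analytic_mult (f g : R -> C) (a : R) :
  curve_analytic f a -> curve_analytic g a ->
  curve_analytic (fun t => f t * g t)%C a.
Proof.
  intros [F1 F2] [G1 G2].
  split; simpl; [apply real_analytic_minus|apply real_analytic_plus]; apply real_analytic_mult; auto.
Qed.

Lemma curve_analytic_minus (f g : R -> C) (a : R) :
  curve_analytic f a -> curve_analytic g a ->
  curve_analytic (fun t => f t - g t)%C a.
Proof. intros [F1 F2] [G1 G2]. split; simpl; apply real_analytic_minus; auto. Qed.

Lemma curve_analytic_real (f : R -> R) (a : R) : real_analytic f a -> curve_analytic (fun t => RtoC (f t)) a.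
Proof. intros F. split; simpl; [exact F|apply real_analytic_const]. Qed.

Lemma curve_analytic_affine (f : R -> C) (k b a : R) :
  curve_analytic f (k * a + b) -> curve_analytic (fun t => f (k * t + b)) a.
Proof. intros [F1 F2]. split; [apply (real_analytic_affine (fun t => Re (f t)))|apply (real_analytic_affine (fun t => Im (f t)))]; auto. Qed.

Lemma sum_n_Re (u : nat -> C) (n : nat) : Re (sum_n u n) = sum_n (fun k => Re (u k)) n.
Proof.
  induction n as [|n IH]; [rewrite !sum_O; auto|].
  rewrite !sum_Sn, <- IH. reflexivity.
Qed.

Lemma sum_n_Im (u : nat -> C) (n : nat) : Im (sum_n u n) = sum_n (fun k => Im (u k)) n.
Proof.
  induction n as [|n IH]; [rewrite !sum_O; auto|].
  rewrite !sum_Sn, <- IH. reflexivity.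
Qed.

Lemma filterlim_Re {T} (F : (T -> Prop) -> Prop) {FF : Filter F} (f : T -> C) (l : C) :
  filterlim f F (locally l) -> filterlim (fun t => Re (f t)) F (locally (Re l)).
Proof.
  intros H. eapply filterlim_comp; [exact H|]. destruct l as [x y].
  apply (continuous_fst (U := R_UniformSpace) (V := R_UniformSpace)).
Qed.

Lemma filterlim_Im {T} (F : (T -> Prop) -> Prop) {FF : Filter F} (f : T -> C) (l : C) :
  filterlim f F (locally l) -> filterlim (fun t => Im (f t)) F (locally (Im l)).
Proof.
  intros H. eapply filterlim_comp; [exact H|]. destruct l as [x y].
  apply (continuous_snd (U := R_UniformSpace) (V := R_UniformSpace)).
Qed.

Lemma filterlim_C {T} (F : (T -> Prop) -> Prop) {FF : Filter F} (f : T -> C) (l : C) :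
  filterlim (fun t => Re (f t)) F (locally (Re l)) ->
  filterlim (fun t => Im (f t)) F (locally (Im l)) -> filterlim f F (locally l).
Proof.
  intros H1 H2. apply filterlim_locally. intros eps.
  generalize (proj1 (filterlim_locally _ _) H1 eps) (proj1 (filterlim_locally _ _) H2 eps).
  intros A B. generalize (filter_and _ _ A B). apply filter_imp. intros t [Ha Hb]. split; auto.
Qed.

Lemma pow_n_RtoC (y : R) (k : nat) : pow_n (K := C_Ring) (RtoC y) k = RtoC (y ^ k).
Proof. induction k as [|k IH]; [reflexivity|]. simpl. rewrite IH. symmetry; apply RtoC_mult. Qed.

(** At a real centre and a real argument the powers are real, so the real and imaginary parts of the
    coefficients expand the two components. *)
Lemma C_analytic_at_curve (f : C -> C) (a : R) :
  C_analytic_at f (RtoC a) -> curve_analytic (fun t => f (RtoC t)) a.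
Proof.
  intros [c [r [Hr H]]].
  assert (K : forall t, Rabs (t - a) < r ->
    filterlim (sum_n (fun k => RtoC ((t - a) ^ k) * c k)%C) eventually (locally (f (RtoC t)))).
  { intros t Ht.
    assert (A : Cmod (RtoC t - RtoC a) < r) by (rewrite <- RtoC_minus, Cmod_R; exact Ht).
    specialize (H _ A). unfold is_pseries, is_series in H.
    eapply filterlim_ext; [|exact H]. intros n. apply sum_n_ext. intros k.
    rewrite <- RtoC_minus, pow_n_RtoC. reflexivity. }
  split; [exists (fun k => Re (c k)), r|exists (fun k => Im (c k)), r]; (split; [auto|]);
    intros t Ht; apply is_pseries_R; specialize (K t Ht).
  - apply filterlim_Re in K. 2: typeclasses eauto.
    eapply filterlim_ext; [|exact K]. intros n. etransitivity; [apply sum_n_Re|]. apply sum_n_ext. intros k.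
    etransitivity; [apply re_scal_l|apply Rmult_comm].
  - apply filterlim_Im in K. 2: typeclasses eauto.
    eapply filterlim_ext; [|exact K]. intros n. etransitivity; [apply sum_n_Im|]. apply sum_n_ext. intros k.
    etransitivity; [apply im_scal_l|apply Rmult_comm].
Qed.

Lemma Cpower_real (y s : R) : 0 < y -> Cpower (RtoC y) (RtoC s) = RtoC (Rpower y s).
Proof.
  intros Hy. unfold Cpower, Clog, Cexp, Rpower. simpl.
  rewrite Cmod_R, Rabs_pos_eq by lra. rewrite Rdiv_0_l, atan_0.
  rewrite !Rmult_0_l, !Rmult_0_r, Rminus_0_r, Rplus_0_r, cos_0, sin_0.
  unfold RtoC. f_equal; ring.
Qed.

Lemma zeta_E2_term_real (tau x s : R) (m1 m2 : nat) : 0 < tau -> 0 < x ->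
  zeta_E2_term tau (RtoC x) (RtoC s) m1 m2
  = RtoC ((-1) ^ (m1 + m2) * Rpower (x + INR m1 * 1 + INR m2 * tau) (- s)).
Proof.
  intros Ht Hx. unfold zeta_E2_term. rewrite <- RtoC_mult, <- !RtoC_plus.
  pose proof (pos_INR m1). pose proof (pos_INR m2).
  rewrite Cpower_real by nra. rewrite <- RtoC_div by (apply Rgt_not_eq, exp_pos).
  rewrite Rpower_Ropp, Rmult_1_r. reflexivity.
Qed.

Lemma sum_n_RtoC (u : nat -> R) (n : nat) :
  sum_n (G := C_AbelianMonoid) (fun k => RtoC (u k)) n = RtoC (sum_n u n).
Proof.
  induction n as [|n IH]; [rewrite !sum_O; auto|].
  rewrite !sum_Sn, IH. symmetry. apply RtoC_plus.
Qed.

Lemma zeta_E2_series_real (tau x s : R) (l : C) : 0 < tau -> 0 < x ->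
  is_zeta_E2_series tau (RtoC x) (RtoC s) l ->
  filterlim (fun N : nat * nat => RtoC (alt_sum2 1 tau x s (fst N) (snd N)))
    (filter_prod eventually eventually) (locally l).
Proof.
  intros Ht Hx H. eapply filterlim_ext; [|exact H]. intros [N M]. simpl.
  unfold alt_sum2. rewrite <- sum_n_RtoC. apply sum_n_ext. intros m1.
  rewrite <- sum_n_RtoC. apply sum_n_ext. intros m2. apply zeta_E2_term_real; auto.
Qed.

(** [C_derive] is defined as a limit along the horizontal line through the point, so it sees only
    the values on the real axis. *)
Lemma C_derive_real (Z : C -> C) :
  C_derive Z 0 = (Derive (fun t => Re (Z (RtoC t))) 0, Derive (fun t => Im (Z (RtoC t))) 0).
Proof.
  unfold C_derive, C_lim, Derive. simpl (fst (RtoC 0)). simpl (snd (RtoC 0)).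
  f_equal; f_equal; apply Lim_ext; intros t; rewrite Rplus_0_l;
    (* The difference quotients are compared at every [t]; at [t = 0] the numerators vanish and both
       sides are 0. *)
    (destruct (Req_dec t 0) as [->|Nt];
     [fold (RtoC 0); unfold Cdiv, Cminus; rewrite Cplus_opp_r, Cmult_0_l; simpl;
      rewrite Rminus_diag; unfold Rdiv; rewrite Rmult_0_l; reflexivity|]);
    unfold RtoC, Cdiv, Cminus, Cmult, Cinv, Cplus, Copp, Re, Im; simpl; field; lra.
Qed.

(** For real [s > 0] all terms are real, so the imaginary part of [Z] vanishes there; one-sided
    comparison in both directions then kills its value and its derivative at 0. Hence [Gam] is the
    exponential of a real number at positive arguments. *)
Lemma zeta_E2_derive (tau x : R) (Z : C -> C) : 0 < tau -> 0 < x ->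
  is_zeta_E2 tau (RtoC x) Z ->
  let z := fun t => Re (Z (RtoC t)) in
  alt_zeta2 1 tau x z /\ is_derive z 0 (Derive z 0) /\ C_derive Z 0 = RtoC (Derive z 0).
Proof.
  intros Ht Hx [H1 H2] z.
  assert (S : forall s, 0 < s -> filterlim
    (fun N : nat * nat => RtoC (alt_sum2 1 tau x s (fst N) (snd N)))
    (filter_prod eventually eventually) (locally (Z (RtoC s)))).
  { intros s Hs. apply zeta_E2_series_real; auto. }
  destruct (C_analytic_at_curve Z 0) as [A1 A2]; [apply H2; right; reflexivity|].
  apply real_analytic_ex_derive in A1, A2.
  split; [|split].
  - intros s Hs. specialize (S s Hs). apply filterlim_Re in S; [exact S|typeclasses eauto].
  - apply Derive_correct. exact A1.
  - rewrite C_derive_real. unfold z.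
    set (w := fun t => Im (Z (RtoC t))) in *.
    assert (W : forall s, 0 < s -> w s = 0).
    { intros s Hs. specialize (S s Hs). apply filterlim_Im in S; [|typeclasses eauto]. simpl in S.
      symmetry. eapply (filterlim_locally_unique (F := filter_prod eventually eventually));
        [apply filterlim_const|exact S]. }
    assert (Cw : continuous w 0)
      by (apply ex_derive_continuous_R; exact A2).
    assert (C0 : continuous (fun _ : R => 0) 0) by apply continuous_const.
    assert (W0 : w 0 = 0).
    { apply Rle_antisym.
      - apply (continuous_le_right w (fun _ => 0)); auto. intros; rewrite W; auto; lra.
      - apply (continuous_le_right (fun _ => 0) w); auto. intros; rewrite W; auto; lra. }
    assert (D0 : is_derive (fun _ : R => 0) 0 0) by apply (is_derive_const (V := R_NormedModule) 0).
    apply Derive_correct in A2.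
    assert (E : Derive w 0 = 0).
    { apply Rle_antisym.
      - apply (derive_le_right w (fun _ => 0)); auto. intros; rewrite W; auto; lra.
      - apply (derive_le_right (fun _ => 0) w); auto. intros; rewrite W; auto; lra. }
    rewrite E. reflexivity.
Qed.

Lemma Cexp_real (d : R) : Cexp (RtoC d) = RtoC (exp d).
Proof. unfold Cexp. simpl. rewrite cos_0, sin_0, Rmult_1_r, Rmult_0_r. reflexivity. Qed.

Lemma Gamma_bar2_real (tau : R) (Gam : C -> P1) : 0 < tau -> is_Gamma_bar2 tau Gam ->
  forall x, 0 < x -> exists (z : R -> R) (d : R),
    alt_zeta2 1 tau x z /\ is_derive z 0 d /\ Gam (RtoC x) = P1_fin (RtoC (exp d)).
Proof.
  intros Ht [HG _] x Hx. destruct (HG (RtoC x) Hx) as [Z [HZ EZ]].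
  destruct (zeta_E2_derive tau x Z Ht Hx HZ) as [A [B E]].
  exists (fun t => Re (Z (RtoC t))), (Derive (fun t => Re (Z (RtoC t))) 0).
  split; [exact A|]. split; [exact B|]. rewrite EZ, E, Cexp_real. reflexivity.
Qed.

(* Only used for [0 < x], where [Gam] takes positive real values. *)
Definition gam (Gam : C -> P1) (x : R) : R :=
  match Gam (RtoC x) with P1_fin z => Re z | P1_inf => 0 end.

Lemma gam_pos (tau : R) (Gam : C -> P1) (x : R) : 0 < tau -> is_Gamma_bar2 tau Gam -> 0 < x ->
  0 < gam Gam x /\ Gam (RtoC x) = P1_fin (RtoC (gam Gam x)).
Proof.
  intros Ht HG Hx. destruct (Gamma_bar2_real tau Gam Ht HG x Hx) as [z [d [_ [_ E]]]].
  unfold gam. rewrite E. simpl. split; [apply exp_pos|reflexivity].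
Qed.

Lemma gam_reflection_aux (b x d1 d2 d3 d4 : R) :
  0 < x < b / 2 -> d1 + d2 - (d3 + d4) = - ln (tan (PI * (x / b) / 2)) ->
  exp d3 * exp d4 = tan (PI * (x / b) / 2) * (exp d1 * exp d2).
Proof.
  intros Hx E.
  assert (T : 0 < tan (PI * (x / b) / 2)).
  { pose proof PI_RGT_0. assert (0 < x / b) by (apply Rdiv_lt_0_compat; lra).
    assert (x / b < / 2).
    { apply (Rmult_lt_reg_r b); [lra|]. unfold Rdiv. rewrite Rmult_assoc, Rinv_l; lra. }
    apply tan_gt_0; nra. }
  rewrite <- (exp_ln _ T), <- !exp_plus. f_equal. lra.
Qed.

Lemma gam_reflection (tau : R) (Gam : C -> P1) (x : R) :
  0 < tau -> is_Gamma_bar2 tau Gam -> 0 < x < tau / 2 ->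
  gam Gam (tau - x) * gam Gam (tau - x + 1)
  = tan (PI * (x / tau) / 2) * (gam Gam x * gam Gam (x + 1)).
Proof.
  intros Ht HG Hx. unfold gam.
  destruct (Gamma_bar2_real tau Gam Ht HG x) as [z1 [d1 [A1 [D1 ->]]]]; [lra|].
  destruct (Gamma_bar2_real tau Gam Ht HG (x + 1)) as [z2 [d2 [A2 [D2 ->]]]]; [lra|].
  destruct (Gamma_bar2_real tau Gam Ht HG (tau - x)) as [z3 [d3 [A3 [D3 ->]]]]; [lra|].
  destruct (Gamma_bar2_real tau Gam Ht HG (tau - x + 1)) as [z4 [d4 [A4 [D4 ->]]]]; [lra|].
  simpl. apply gam_reflection_aux; [exact Hx|].
  apply (alt_zeta2_derive 1 tau x d1 d2 d3 d4 z1 z2 z3 z4); auto; lra.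
Qed.

Lemma gam_reflection' (tau : R) (Gam : C -> P1) (x : R) :
  0 < tau -> is_Gamma_bar2 tau Gam -> 0 < x < 1 / 2 ->
  gam Gam (1 - x) * gam Gam (1 - x + tau)
  = tan (PI * (x / 1) / 2) * (gam Gam x * gam Gam (x + tau)).
Proof.
  intros Ht HG Hx. unfold gam.
  destruct (Gamma_bar2_real tau Gam Ht HG x) as [z1 [d1 [A1 [D1 ->]]]]; [lra|].
  destruct (Gamma_bar2_real tau Gam Ht HG (x + tau)) as [z2 [d2 [A2 [D2 ->]]]]; [lra|].
  destruct (Gamma_bar2_real tau Gam Ht HG (1 - x)) as [z3 [d3 [A3 [D3 ->]]]]; [lra|].
  destruct (Gamma_bar2_real tau Gam Ht HG (1 - x + tau)) as [z4 [d4 [A4 [D4 ->]]]]; [lra|].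
  simpl. apply gam_reflection_aux; [exact Hx|].
  apply (alt_zeta2_derive tau 1 x d1 d2 d3 d4 z1 z2 z3 z4); auto; try lra;
    apply alt_zeta2_swap; auto.
Qed.

(** * Reflection formulas *)

Lemma P1_meromorphic_real (G : C -> P1) (a : R) : P1_meromorphic G ->
  exists f : R -> C, curve_analytic f a /\
    (locally a (fun x => G (RtoC x) = P1_fin (f x)) \/
     locally a (fun x => P1_inv (G (RtoC x)) = P1_fin (f x))).
Proof.
  intros HG. destruct (HG (RtoC a)) as [f [r [Hf [Hr H]]]].
  exists (fun x => f (RtoC x)). split; [apply C_analytic_at_curve, Hf|].
  destruct H as [H|H]; [left|right]; exists (mkposreal r Hr); intros x Hx; apply H;
    rewrite <- RtoC_minus, Cmod_R; exact Hx.
Qed.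

(** Continuity is read off the meromorphic structure. In the chart at infinity the analytic function
    is the inverse of [gam], and positivity keeps it away from 0. *)
Lemma gam_continuous (tau : R) (Gam : C -> P1) (a : R) :
  0 < tau -> is_Gamma_bar2 tau Gam -> 0 < a -> continuous (gam Gam) a.
Proof.
  intros Ht HG Ha. pose proof (proj2 HG) as HG1.
  assert (Lp : locally a (fun x => 0 < x)) by (apply (open_gt 0); exact Ha).
  destruct (P1_meromorphic_real Gam a HG1) as [f [Hf [H|H]]].
  - apply (continuous_ext_loc _ (fun x => Re (f x))).
    + generalize H. apply filter_imp. intros x Hx. unfold gam. rewrite Hx. reflexivity.
    + apply ex_derive_continuous_R, real_analytic_ex_derive, Hf.
  - assert (H' : locally a (fun x => Re (f x) = / gam Gam x)).
    { generalize (filter_and _ _ H Lp). apply filter_imp. intros x [Hx Px].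
      destruct (gam_pos tau Gam x Ht HG Px) as [P E]. rewrite E in Hx. simpl in Hx.
      destruct (Ceq_dec _ _) as [Z|_]; [apply RtoC_inj in Z; lra|].
      injection Hx as Hx. rewrite <- Hx, <- RtoC_inv by lra. reflexivity. }
    apply (continuous_ext_loc _ (fun x => / Re (f x))).
    + generalize H'. apply filter_imp. intros x Hx. rewrite Hx. apply Rinv_inv.
    + apply (continuous_comp (fun x => Re (f x)) Rinv).
      * apply ex_derive_continuous_R, real_analytic_ex_derive, Hf.
      * apply continuity_pt_filterlim. apply continuity_pt_inv; [apply continuity_pt_id|].
        rewrite (locally_singleton _ _ H').
        destruct (gam_pos tau Gam a Ht HG Ha). apply Rgt_not_eq, Rinv_0_lt_compat; auto.
Qed.

Lemma derive_quotient_right (f : R -> R) (l : R) :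
  is_derive f 0 l -> f 0 = 0 -> filterlim (fun x => f x / x) (at_right 0) (locally l).
Proof.
  intros D E. apply is_derive_Reals in D. apply filterlim_locally. intros eps.
  destruct (D eps (cond_pos eps)) as [d Hd].
  exists d. intros x Hx Px.
  unfold ball in *; simpl in *; unfold AbsRing_ball, abs, minus, plus, opp in *; simpl in *.
  rewrite Ropp_0, Rplus_0_r in Hx.
  specialize (Hd x ltac:(lra) Hx). rewrite Rplus_0_l, E, Rminus_0_r in Hd. exact Hd.
Qed.

Lemma filterlim_Rmult {T} (F : (T -> Prop) -> Prop) {FF : Filter F} (f g : T -> R) (l m : R) :
  filterlim f F (locally l) -> filterlim g F (locally m) ->
  filterlim (fun t => f t * g t) F (locally (l * m)).
Proof.
  intros Hf Hg. eapply filterlim_comp_2; [exact Hf|exact Hg|apply (filterlim_mult (K := R_AbsRing))].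
Qed.

Lemma filterlim_affine_right (g : R -> R) (k b : R) : continuous g b ->
  filterlim (fun x => g (k * x + b)) (at_right 0) (locally (g b)).
Proof.
  intros Hg.
  assert (H : continuous (fun x => g (k * x + b)) 0).
  { apply (continuous_comp (fun x => k * x + b) g).
    - apply ex_derive_continuous_R; auto_derive; auto.
    - rewrite Rmult_0_r, Rplus_0_l; exact Hg. }
  unfold continuous in H. rewrite Rmult_0_r, Rplus_0_l in H.
  eapply filterlim_filter_le_1; [|exact H]. intros P HP. unfold at_right, within.
  eapply filter_imp; [|exact HP]; auto.
Qed.

Lemma tan_quotient_right (b : R) : 0 < b ->
  filterlim (fun x => tan (PI * (x / b) / 2) / x) (at_right 0) (locally (PI / (2 * b))).
Proof.
  intros Hb. apply derive_quotient_right.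
  - unfold tan. auto_derive.
    + rewrite Rmult_0_l, Rmult_0_r, Rmult_0_l, cos_0. lra.
    + rewrite Rmult_0_l, Rmult_0_r, Rmult_0_l, cos_0, sin_0. field. lra.
  - rewrite Rdiv_0_l, Rmult_0_r, Rdiv_0_l. apply tan_0.
Qed.

(* Dividing the two reflection formulas cancels [gam x] and [gam (1 + tau - x)]; the limit
   [x -> 0+] then determines the square of the left-hand side. *)
Lemma gam_ratio (tau : R) (Gam : C -> P1) :
  0 < tau -> is_Gamma_bar2 tau Gam -> gam Gam tau / gam Gam 1 = / sqrt tau.
Proof.
  intros Ht HG.
  destruct (gam_pos tau Gam tau Ht HG Ht) as [Pt _].
  destruct (gam_pos tau Gam 1 Ht HG ltac:(lra)) as [P1_ _].
  (* Both sides are limits of one function of [x]. The tangents vanish at 0 and are therefore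
     divided by [x]; their slopes [PI / 2] and [PI / (2 * tau)] are the origin of the factor
     [tau]. *)
  assert (E : PI / (2 * 1) * (gam Gam tau * gam Gam tau) = PI / (2 * tau) * (gam Gam 1 * gam Gam 1)).
  { pose proof (gam_continuous tau Gam tau Ht HG Ht) as Ct.
    pose proof (gam_continuous tau Gam 1 Ht HG ltac:(lra)) as C1.
    eapply (filterlim_locally_unique (F := at_right 0)
      (fun x => tan (PI * (x / 1) / 2) / x * (gam Gam (-1 * x + tau) * gam Gam (1 * x + tau)))).
    - apply filterlim_Rmult; [typeclasses eauto|apply tan_quotient_right; lra|].
      apply filterlim_Rmult; [typeclasses eauto|..]; apply (filterlim_affine_right (gam Gam)); auto.
    - apply (filterlim_ext_loc
      (fun x => tan (PI * (x / tau) / 2) / x * (gam Gam (-1 * x + 1) * gam Gam (1 * x + 1)))).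
      + exists (mkposreal (Rmin (tau / 2) (1 / 2)) ltac:(apply Rmin_pos; lra)).
        intros x Hx Px.
        unfold ball in *; simpl in *; unfold AbsRing_ball, abs, minus, plus, opp in *; simpl in *.
        rewrite Ropp_0, Rplus_0_r, Rabs_pos_eq in Hx by lra.
        pose proof (Rmin_l (tau / 2) (1 / 2)). pose proof (Rmin_r (tau / 2) (1 / 2)).
        pose proof (gam_reflection tau Gam x Ht HG ltac:(lra)) as R1.
        pose proof (gam_reflection' tau Gam x Ht HG ltac:(lra)) as R2.
        replace (1 - x + tau) with (tau - x + 1) in R2 by ring.
        replace (-1 * x + tau) with (tau - x) by ring.
        replace (-1 * x + 1) with (1 - x) by ring. rewrite Rmult_1_l.
        destruct (gam_pos tau Gam x Ht HG ltac:(lra)) as [Q1 _].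
        destruct (gam_pos tau Gam (tau - x + 1) Ht HG ltac:(lra)) as [Q2 _].
        apply (Rmult_eq_reg_r (gam Gam x * gam Gam (tau - x + 1)));
          [|apply Rgt_not_eq, Rmult_lt_0_compat; auto].
        transitivity (gam Gam (1 - x) * gam Gam (tau - x + 1)
          * (tan (PI * (x / tau) / 2) * (gam Gam x * gam Gam (x + 1))) / x); [field; lra|].
        rewrite <- R1, R2. field; lra.
      + apply filterlim_Rmult; [typeclasses eauto|apply tan_quotient_right; lra|].
        apply filterlim_Rmult; [typeclasses eauto|..]; apply (filterlim_affine_right (gam Gam)); auto. }
  pose proof PI_RGT_0. pose proof (sqrt_lt_R0 tau Ht) as Ps. pose proof (sqrt_sqrt tau ltac:(lra)) as Es.
  assert (E2 : (gam Gam tau * sqrt tau)² = (gam Gam 1)²).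
  { unfold Rsqr. apply (Rmult_eq_reg_l (PI / (2 * tau))).
    - rewrite <- E. replace (gam Gam tau * sqrt tau * (gam Gam tau * sqrt tau))
        with (gam Gam tau * gam Gam tau * (sqrt tau * sqrt tau)) by ring. rewrite Es. field. lra.
    - apply Rgt_not_eq, Rdiv_lt_0_compat; lra. }
  apply Rsqr_inj in E2; [|apply Rmult_le_pos; lra|lra].
  rewrite <- E2. field. split; lra.
Qed.

(** * The reflection formula in homogeneous coordinates *)

Definition P1_num (p : P1) : C := match p with P1_fin z => z | P1_inf => RtoC 1 end.
Definition P1_den (p : P1) : C := match p with P1_fin _ => RtoC 1 | P1_inf => RtoC 0 end.

(** The normalised coordinates jump at poles. They become analytic after multiplication by a
    non-zero factor that may vary with [x], which is harmless in a homogeneous relation. *)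
Lemma P1_meromorphic_coordinates (G : C -> P1) (k b a : R) : P1_meromorphic G ->
  exists N D : R -> C, curve_analytic N a /\ curve_analytic D a /\
    locally a (fun x => exists l : C, l <> RtoC 0 /\
      N x = (l * P1_num (G (RtoC (k * x + b))))%C /\
      D x = (l * P1_den (G (RtoC (k * x + b))))%C).
Proof.
  intros HG. destruct (P1_meromorphic_real G (k * a + b) HG) as [f [Hf H]].
  assert (Hc : continuous (fun x => k * x + b) a)
    by (apply ex_derive_continuous_R; auto_derive; auto).
  assert (H1 : curve_analytic (fun _ => RtoC 1) a) by apply (curve_analytic_real (fun _ => 1)), real_analytic_const.
  assert (N1 : RtoC 1 <> RtoC 0) by (intros E; apply RtoC_inj in E; lra).
  apply curve_analytic_affine in Hf.
  destruct H as [H|H]; [exists (fun x => f (k * x + b)), (fun _ => RtoC 1)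
                       |exists (fun _ => RtoC 1), (fun x => f (k * x + b))];
    (split; [assumption|]); (split; [assumption|]);
    generalize (Hc _ H); unfold filtermap; apply filter_imp; intros x Hx.
  - exists (RtoC 1). rewrite Hx. simpl. split; [auto|]. split; ring.
  - destruct (G (RtoC (k * x + b))) as [z|]; simpl in *.
    (* In the chart at infinity the analytic coordinates are 1 and [/ z], that is [/ z] times the
       normalised ones. *)
    + destruct (Ceq_dec z 0) as [|Nz]; [discriminate|]. injection Hx as Hx.
      exists (/ z)%C. split; [|split].
      * intros E. apply N1. rewrite <- (Cinv_l z Nz), E. ring.
      * rewrite Cinv_l; auto.
      * rewrite <- Hx. ring.
    + injection Hx as Hx. exists (RtoC 1). rewrite <- Hx. split; [auto|]. split; ring.
Qed.

(* [Gam (1 + tau - x) Gam (tau - x) cos = Gam (x) Gam (x + 1) sin], cleared of denominators so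
   that it also makes sense at poles; [P1_num] and [P1_den] are homogeneous coordinates.
   The cosine is a shifted sine because [real_analytic_sin_affine] covers only sines. *)
Definition reflection_at (tau : R) (Gam : C -> P1) (x : R) : Prop :=
  let n k b := P1_num (Gam (RtoC (k * x + b))) in
  let d k b := P1_den (Gam (RtoC (k * x + b))) in
  (n (-1) (1 + tau)%R * n (-1) tau * (d 1%R 0%R * d 1%R 1%R) * RtoC (sin (PI / (2 * tau) * x + PI / 2))
   = d (-1) (1 + tau)%R * d (-1) tau * (n 1%R 0%R * n 1%R 1%R) * RtoC (sin (PI / (2 * tau) * x + 0)))%C.

(** Each side of the relation contains exactly one coordinate of each of the four points, so passing
    to analytic coordinates multiplies both sides by the same non-zero factor. Locally the relation
    is thus the vanishing of an analytic function, and it continues from the interval of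
    [gam_reflection]. *)
Lemma reflection_all (tau : R) (Gam : C -> P1) : 0 < tau -> is_Gamma_bar2 tau Gam ->
  forall x, 0 < x -> reflection_at tau Gam x.
Proof.
  intros Ht HG.
  apply (analytic_continuation _ 0 (tau / 2)); [lra| |].
  - intros x Hx. unfold reflection_at.
    replace (-1 * x + (1 + tau)) with (tau - x + 1) by ring.
    replace (-1 * x + tau) with (tau - x) by ring.
    replace (1 * x + 0) with x by ring. replace (1 * x + 1) with (x + 1) by ring.
    destruct (gam_pos tau Gam x Ht HG) as [_ ->]; [lra|].
    destruct (gam_pos tau Gam (x + 1) Ht HG) as [_ ->]; [lra|].
    destruct (gam_pos tau Gam (tau - x) Ht HG) as [_ ->]; [lra|].
    destruct (gam_pos tau Gam (tau - x + 1) Ht HG) as [_ ->]; [lra|].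
    simpl. rewrite <- !RtoC_mult. f_equal.
    pose proof (gam_reflection tau Gam x Ht HG Hx) as E.
    rewrite Rplus_0_r. replace (PI / (2 * tau) * x + PI / 2) with (PI / 2 + PI / (2 * tau) * x) by ring.
    rewrite <- cos_sin.
    replace (PI * (x / tau) / 2) with (PI / (2 * tau) * x) in E by (field; lra).
    assert (cos (PI / (2 * tau) * x) <> 0).
    { apply Rgt_not_eq, cos_gt_0.
      - apply Rlt_trans with 0; [pose proof PI_RGT_0; lra|]. apply Rmult_lt_0_compat; [|lra].
        apply Rdiv_lt_0_compat; [apply PI_RGT_0|lra].
      - replace (PI / 2) with (PI / (2 * tau) * tau) by (field; lra).
        apply Rmult_lt_compat_l; [|lra]. apply Rdiv_lt_0_compat; [apply PI_RGT_0|lra]. }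
    rewrite !Rmult_1_l, Rmult_1_r, (Rmult_comm (gam Gam (tau - x + 1))), E. unfold tan. field; auto.
  - intros b.
    destruct HG as [_ HG].
    destruct (P1_meromorphic_coordinates Gam (-1) (1 + tau) b HG) as [N1 [D1 [AN1 [AD1 L1]]]].
    destruct (P1_meromorphic_coordinates Gam (-1) tau b HG) as [N2 [D2 [AN2 [AD2 L2]]]].
    destruct (P1_meromorphic_coordinates Gam 1 0 b HG) as [N3 [D3 [AN3 [AD3 L3]]]].
    destruct (P1_meromorphic_coordinates Gam 1 1 b HG) as [N4 [D4 [AN4 [AD4 L4]]]].
    pose (F := fun x => (N1 x * N2 x * (D3 x * D4 x) * RtoC (sin (PI / (2 * tau) * x + PI / 2))
      - D1 x * D2 x * (N3 x * N4 x) * RtoC (sin (PI / (2 * tau) * x + 0)))%C).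
    assert (AF : curve_analytic F b).
    { apply curve_analytic_minus; repeat apply curve_analytic_mult; auto;
      apply (curve_analytic_real (fun x => sin (PI / (2 * tau) * x + _))); apply real_analytic_sin_affine. }
    (* A sum of two squares turns the complex equation into a single real analytic one. *)
    exists (fun x => Re (F x) * Re (F x) + Im (F x) * Im (F x)). split.
    { destruct AF. apply real_analytic_plus; apply real_analytic_mult; auto. }
    generalize (filter_and _ _ (filter_and _ _ L1 L2) (filter_and _ _ L3 L4)).

    apply filter_imp.
    intros x [[[l1 [Q1 [E1 E1']]] [l2 [Q2 [E2 E2']]]] [[l3 [Q3 [E3 E3']]] [l4 [Q4 [E4 E4']]]]].
    unfold F, reflection_at. rewrite E1, E2, E3, E4, E1', E2', E3', E4'.
    set (n1 := P1_num (Gam (RtoC (-1 * x + (1 + tau))))). set (n2 := P1_num (Gam (RtoC (-1 * x + tau)))).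
    set (n3 := P1_num (Gam (RtoC (1 * x + 0)))). set (n4 := P1_num (Gam (RtoC (1 * x + 1)))).
    set (d1 := P1_den (Gam (RtoC (-1 * x + (1 + tau))))). set (d2 := P1_den (Gam (RtoC (-1 * x + tau)))).
    set (d3 := P1_den (Gam (RtoC (1 * x + 0)))). set (d4 := P1_den (Gam (RtoC (1 * x + 1)))).
    set (c := RtoC (sin (PI / (2 * tau) * x + PI / 2))). set (s := RtoC (sin (PI / (2 * tau) * x + 0))).
    assert (EF : (l1 * n1 * (l2 * n2) * (l3 * d3 * (l4 * d4)) * c -
      l1 * d1 * (l2 * d2) * (l3 * n3 * (l4 * n4)) * s
      = l1 * l2 * (l3 * l4) * (n1 * n2 * (d3 * d4) * c - d1 * d2 * (n3 * n4) * s))%C) by ring.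
    rewrite EF. set (w := (n1 * n2 * (d3 * d4) * c - d1 * d2 * (n3 * n4) * s)%C).
    set (l := (l1 * l2 * (l3 * l4))%C).
    assert (Ql : l <> RtoC 0) by (repeat apply Cmult_neq_0; auto).
    split; intros H.
    + assert (Z : w = RtoC 0) by (unfold w; rewrite H; ring). rewrite Z. simpl. ring.
    + assert (Z : (l * w)%C = RtoC 0).
      { revert H. generalize (l * w)%C. intros [p q] H. unfold Re, Im in H; simpl in H.
        unfold RtoC. f_equal; nra. }
      assert (Zw : w = RtoC 0).
      { apply NNPP. intros Nw. apply (Cmult_neq_0 l w Ql Nw Z). }
      transitivity (w + d1 * d2 * (n3 * n4) * s)%C; [unfold w; ring|rewrite Zw; ring].
Qed.

(** * Convergence in the projective line *)

Lemma filterlim_Rplus {T} (F : (T -> Prop) -> Prop) {FF : Filter F} (f g : T -> R) (l m : R) :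
  filterlim f F (locally l) -> filterlim g F (locally m) ->
  filterlim (fun t => f t + g t) F (locally (l + m)).
Proof.
  intros Hf Hg. eapply filterlim_comp_2; [exact Hf|exact Hg|apply (filterlim_plus (V := R_NormedModule))].
Qed.

Lemma filterlim_Cmult {T} (F : (T -> Prop) -> Prop) {FF : Filter F} (f g : T -> C) (l m : C) :
  filterlim f F (locally l) -> filterlim g F (locally m) ->
  filterlim (fun t => f t * g t)%C F (locally (l * m)%C).
Proof.
  intros Hf Hg.
  pose proof (filterlim_Re F f l Hf) as F1. pose proof (filterlim_Im F f l Hf) as F2.
  pose proof (filterlim_Re F g m Hg) as G1. pose proof (filterlim_Im F g m Hg) as G2.
  apply filterlim_C; [exact FF| |].
  - rewrite re_mult.
    apply (filterlim_ext (fun t => Re (f t) * Re (g t) + -1 * (Im (f t) * Im (g t)))).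
    { intros t. rewrite re_mult. ring. }
    replace (Re l * Re m - Im l * Im m) with (Re l * Re m + -1 * (Im l * Im m)) by ring.
    apply filterlim_Rplus; [exact FF|apply filterlim_Rmult; auto|].
    apply filterlim_Rmult; [exact FF|apply filterlim_const|apply filterlim_Rmult; auto].
  - rewrite im_mult.
    apply (filterlim_ext (fun t => Re (f t) * Im (g t) + Im (f t) * Re (g t))).
    { intros t. rewrite im_mult. ring. }
    apply filterlim_Rplus; [exact FF|apply filterlim_Rmult; auto|apply filterlim_Rmult; auto].
Qed.

Lemma filterlim_Cinv {T} (F : (T -> Prop) -> Prop) {FF : Filter F} (f : T -> C) (l : C) :
  l <> RtoC 0 -> filterlim f F (locally l) -> filterlim (fun t => / f t)%C F (locally (/ l)%C).
Proof.
  intros Nl Hf.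
  pose proof (filterlim_Re F f l Hf) as F1. pose proof (filterlim_Im F f l Hf) as F2.
  assert (S : filterlim (fun t => / (Re (f t) * Re (f t) + Im (f t) * Im (f t))) F
    (locally (/ (Re l * Re l + Im l * Im l)))).
  { eapply filterlim_comp.
    - apply filterlim_Rplus; [exact FF|apply filterlim_Rmult; eassumption|apply filterlim_Rmult; eassumption].
    - apply continuous_Rinv. intros E. apply Nl. destruct l as [p q]. simpl in E.
      unfold RtoC. f_equal; nra. }
  apply filterlim_C; [exact FF| |].
  - replace (Re (/ l)%C) with (Re l * / (Re l * Re l + Im l * Im l))
      by (simpl; unfold Re, Im, Rdiv; rewrite !Rmult_1_r; reflexivity).
    apply (filterlim_ext (fun t => Re (f t) * / (Re (f t) * Re (f t) + Im (f t) * Im (f t)))).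
    { intros t. simpl; unfold Re, Im, Rdiv; rewrite !Rmult_1_r; reflexivity. }
    apply filterlim_Rmult; auto.
  - replace (Im (/ l)%C) with (-1 * Im l * / (Re l * Re l + Im l * Im l))
      by (simpl; unfold Re, Im, Rdiv; rewrite !Rmult_1_r; f_equal; ring).
    apply (filterlim_ext (fun t => -1 * Im (f t) * / (Re (f t) * Re (f t) + Im (f t) * Im (f t)))).
    { intros t. simpl; unfold Re, Im, Rdiv; rewrite !Rmult_1_r; f_equal; ring. }
    apply filterlim_Rmult; auto. apply filterlim_Rmult; auto. apply filterlim_const.
Qed.

Lemma Cinv_neq_0 (z : C) : z <> RtoC 0 -> (/ z)%C <> RtoC 0.
Proof.
  intros Nz E. apply (f_equal (Cmult z)) in E. rewrite Cinv_r, Cmult_0_r in E by auto.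
  apply RtoC_inj in E. lra.
Qed.

Lemma Cinv_inv (z : C) : z <> RtoC 0 -> (/ / z)%C = z.
Proof.
  intros Nz. pose proof (Cinv_neq_0 z Nz). field. auto.
Qed.

Lemma Cinv_mul (z w : C) : z <> RtoC 0 -> w <> RtoC 0 -> (/ (z * w))%C = (/ z * / w)%C.
Proof. intros; field; auto. Qed.

(* Values in C^* near 0 are part of the definition: zeros and poles may occur only at 0. *)
Definition P1_tendsto (h : R -> C) (v : P1) : Prop :=
  locally' 0 (fun e => h e <> RtoC 0) /\
  match v with
  | P1_fin w => filterlim h (locally' 0) (locally w)
  | P1_inf => filterlim (fun e => / h e)%C (locally' 0) (locally (RtoC 0))
  end.

#[local] Instance locally'_0_proper : ProperFilter (locally' (T := R_UniformSpace) 0) :=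
  Rbar_locally'_filter 0.

Lemma P1_tendsto_ext (h k : R -> C) (v : P1) :
  locally' 0 (fun e => h e = k e) -> P1_tendsto h v -> P1_tendsto k v.
Proof.
  intros E [N H]. split.
  - generalize (filter_and _ _ E N). apply filter_imp. intros e [-> He]; exact He.
  - destruct v as [w|].
    + apply (filterlim_ext_loc h k E H).
    + apply (filterlim_ext_loc (fun e => / h e)%C); [|exact H].
      generalize E; apply filter_imp. intros e ->; reflexivity.
Qed.

Lemma P1_tendsto_mul (h k : R -> C) (p q r : P1) :
  P1_tendsto h p -> P1_tendsto k q -> P1_mul p q = Some r ->
  P1_tendsto (fun e => h e * k e)%C r.
Proof.
  intros [Nh Hh] [Nk Hk] E.
  pose proof (filter_and _ _ Nh Nk) as N. split.
  { generalize N; apply filter_imp; intros e [A B]; apply Cmult_neq_0; auto. }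
  assert (I : locally' 0 (fun e => (/ h e * / k e)%C = (/ (h e * k e))%C)).
  { generalize N; apply filter_imp; intros e [A B]; symmetry; apply Cinv_mul; auto. }
  destruct p as [z|], q as [w|]; simpl in E.
  - injection E as <-. apply filterlim_Cmult; auto. typeclasses eauto.
  - destruct (Ceq_dec z 0) as [|Nz]; [discriminate|]. injection E as <-.
    apply (filterlim_ext_loc _ _ I). replace (RtoC 0) with (/ z * 0)%C by ring.
    apply filterlim_Cmult; [typeclasses eauto| |exact Hk].
    apply filterlim_Cinv; auto. typeclasses eauto.
  - destruct (Ceq_dec w 0) as [|Nw]; [discriminate|]. injection E as <-.
    apply (filterlim_ext_loc _ _ I). replace (RtoC 0) with (0 * / w)%C by ring.
    apply filterlim_Cmult; [typeclasses eauto|exact Hh|].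
    apply filterlim_Cinv; auto. typeclasses eauto.
  - injection E as <-. apply (filterlim_ext_loc _ _ I). replace (RtoC 0) with (0 * 0)%C by ring.
    apply filterlim_Cmult; auto. typeclasses eauto.
Qed.

Lemma P1_tendsto_inv (h : R -> C) (p : P1) :
  P1_tendsto h p -> P1_tendsto (fun e => / h e)%C (P1_inv p).
Proof.
  intros [Nh Hh]. split.
  { generalize Nh; apply filter_imp; intros e; apply Cinv_neq_0. }
  destruct p as [z|]; simpl; [|exact Hh].
  destruct (Ceq_dec z 0) as [Ez|Nz].
  - apply (filterlim_ext_loc h); [|rewrite <- Ez; exact Hh].
    generalize Nh; apply filter_imp; intros e He; symmetry; apply Cinv_inv, He.
  - apply filterlim_Cinv; auto. typeclasses eauto.
Qed.

Lemma filterlim_C_unique (h : R -> C) (v w : C) :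
  filterlim h (locally' 0) (locally v) -> filterlim h (locally' 0) (locally w) -> v = w.
Proof.
  intros H1 H2.
  pose proof (filterlim_Re (locally' 0) h v H1) as A1. pose proof (filterlim_Re (locally' 0) h w H2) as A2.
  pose proof (filterlim_Im (locally' 0) h v H1) as B1. pose proof (filterlim_Im (locally' 0) h w H2) as B2.
  pose proof (filterlim_locally_unique (F := locally' 0) _ _ _ A1 A2) as A.
  pose proof (filterlim_locally_unique (F := locally' 0) _ _ _ B1 B2) as B.
  destruct v, w; simpl in *; congruence.
Qed.

Lemma P1_tendsto_fin_inf (h : R -> C) (w : C) :
  P1_tendsto h (P1_fin w) -> P1_tendsto h P1_inf -> False.
Proof.
  intros [N H1] [_ H2].
  (* With both limits the constant function 1 would tend to [w * 0]. *)
  assert (H : filterlim (fun e => h e * / h e)%C (locally' 0) (locally (w * 0)%C))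
    by (apply filterlim_Cmult; auto; typeclasses eauto).
  assert (H' : filterlim (fun e => h e * / h e)%C (locally' 0) (locally (RtoC 1))).
  { apply (filterlim_ext_loc (fun _ => RtoC 1)); [|apply filterlim_const].
    generalize N; apply filter_imp; intros e He. rewrite Cinv_r; auto. }
  pose proof (filterlim_C_unique _ _ _ H H') as E. rewrite Cmult_0_r in E.
  apply RtoC_inj in E. lra.
Qed.

Lemma P1_tendsto_unique (h : R -> C) (v w : P1) :
  P1_tendsto h v -> P1_tendsto h w -> v = w.
Proof.
  intros Hv Hw. destruct v as [v|], w as [w|]; auto.
  - f_equal. apply (filterlim_C_unique h); [apply Hv|apply Hw].
  - destruct (P1_tendsto_fin_inf h v Hv Hw).
  - destruct (P1_tendsto_fin_inf h w Hw Hv).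
Qed.

Lemma P1_tendsto_lim0 (f : R -> option P1) (h : R -> C) (v : P1) :
  locally' 0 (fun e => f e = Some (P1_fin (h e))) -> P1_tendsto h v -> P1_lim0 f v.
Proof.
  intros E [N H]. destruct v as [w|]; simpl.
  - exists h. auto.
  - exists (fun e => / h e)%C. split; [|exact H].
    generalize (filter_and _ _ E N). apply filter_imp. intros e [Ee Ne].
    exists (P1_fin (h e)). split; [exact Ee|]. simpl. destruct (Ceq_dec (h e) 0); [contradiction|reflexivity].
Qed.

Lemma P1_tendsto_real (h : R -> R) (w : R) :
  w <> 0 -> filterlim h (locally' 0) (locally w) -> P1_tendsto (fun e => RtoC (h e)) (P1_fin (RtoC w)).
Proof.
  intros Nw H. split.
  - assert (L : locally w (fun y => y <> 0)) by (apply (open_neq 0); exact Nw).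
    generalize (H _ L). unfold filtermap. apply filter_imp. intros e He E.
    apply RtoC_inj in E. auto.
  - apply filterlim_C; [typeclasses eauto|exact H|simpl; apply filterlim_const].
Qed.

Lemma continuous_punctured (f : R -> R) (k b : R) : continuous f b ->
  filterlim (fun e => f (k * e + b)) (locally' 0) (locally (f b)).
Proof.
  intros Hf.
  assert (H : continuous (fun x => f (k * x + b)) 0).
  { apply (continuous_comp (fun x => k * x + b) f).
    - apply ex_derive_continuous_R; auto_derive; auto.
    - rewrite Rmult_0_r, Rplus_0_l; exact Hf. }
  unfold continuous in H. rewrite Rmult_0_r, Rplus_0_l in H.
  eapply filterlim_filter_le_1; [|exact H]. intros P HP. unfold locally', within.
  eapply filter_imp; [|exact HP]; auto.
Qed.

Lemma locally'_affine (P : R -> Prop) (k b : R) : locally b P -> locally' 0 (fun e => P (k * e + b)).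
Proof.
  intros H. assert (C : continuous (fun x => k * x + b) 0)
    by (apply ex_derive_continuous_R; auto_derive; auto).
  unfold continuous in C. rewrite Rmult_0_r, Rplus_0_l in C.
  unfold locally', within. generalize (C P H). unfold filtermap. apply filter_imp. auto.
Qed.

(** Continuity of a meromorphic function as a map into the projective line. In the chart at infinity
    the limit is found for [/ h] and then inverted. *)
Lemma P1_meromorphic_tendsto (G : C -> P1) (k b : R) (h : R -> C) : P1_meromorphic G ->
  locally' 0 (fun e => h e <> RtoC 0 /\ G (RtoC (k * e + b)) = P1_fin (h e)) ->
  P1_tendsto h (G (RtoC b)).
Proof.
  intros HG H. destruct (P1_meromorphic_real G b HG) as [f [Hf L]].
  assert (N : locally' 0 (fun e => h e <> RtoC 0)).
  { generalize H; apply filter_imp; intros e []; auto. }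
  assert (Lf : filterlim (fun e => f (k * e + b)) (locally' 0) (locally (f b))).
  { destruct Hf as [F1 F2]. apply filterlim_C; [typeclasses eauto| |].
    - apply (continuous_punctured (fun x => Re (f x))).
      apply ex_derive_continuous_R, real_analytic_ex_derive, F1.
    - apply (continuous_punctured (fun x => Im (f x))).
      apply ex_derive_continuous_R, real_analytic_ex_derive, F2. }
  destruct L as [L|L]; pose proof (locally_singleton _ _ L) as Lb; cbv beta in Lb;
    apply (locally'_affine _ k) in L; pose proof (filter_and _ _ H L) as HL.
  - rewrite Lb. split; [exact N|]. apply (filterlim_ext_loc (fun e => f (k * e + b))); [|exact Lf].
    generalize HL; apply filter_imp. intros e [[_ E1] E2]. rewrite E1 in E2. injection E2; auto.
  - assert (T : P1_tendsto (fun e => / h e)%C (P1_fin (f b))).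
    { apply (P1_tendsto_ext (fun e => f (k * e + b))).
      - generalize HL; apply filter_imp. intros e [[Ne E1] E2]. rewrite E1 in E2. simpl in E2.
        destruct (Ceq_dec (h e) 0); [contradiction|]. injection E2; auto.
      - split; [|exact Lf]. generalize HL; apply filter_imp. intros e [[Ne E1] E2]. rewrite E1 in E2. simpl in E2.
        destruct (Ceq_dec (h e) 0); [contradiction|]. injection E2 as <-. apply Cinv_neq_0, Ne. }
    apply P1_tendsto_inv in T.
    replace (P1_inv (P1_fin (f b))) with (G (RtoC b)) in T.
    + eapply P1_tendsto_ext; [|exact T]. generalize N; apply filter_imp; intros e He; apply Cinv_inv, He.
    + rewrite <- Lb. destruct (G (RtoC b)) as [z|]; simpl.
      * destruct (Ceq_dec z 0) as [->|Nz]; [reflexivity|].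
        simpl. destruct (Ceq_dec (/ z) 0) as [E|_]; [destruct (Cinv_neq_0 z Nz E)|].
        rewrite Cinv_inv; auto.
      * destruct (Ceq_dec 0 0); congruence.
Qed.

Lemma sin_punctured (k b : R) : k <> 0 -> locally' 0 (fun e => sin (k * e + b) <> 0).
Proof.
  intros Hk. destruct (Req_dec (sin b) 0) as [E|N].
  - assert (Cb : cos b <> 0).
    { intros Z. pose proof (sin2_cos2 b) as S. rewrite E, Z in S. unfold Rsqr in S. lra. }
    assert (Pk : 0 < Rabs k) by (apply Rabs_pos_lt; auto).
    (* At a zero [b] the sine factors as [sin (k * e) * cos b], and this radius keeps [k * e]
       strictly between [- PI] and [PI]. *)
    exists (mkposreal (PI / Rabs k) ltac:(apply Rdiv_lt_0_compat; [apply PI_RGT_0|auto])).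
    intros e He Ne.
    unfold ball in *; simpl in *; unfold AbsRing_ball, abs, minus, plus, opp in *; simpl in *.
    rewrite Ropp_0, Rplus_0_r in He.
    rewrite sin_plus, E, Rmult_0_r, Rplus_0_r. apply Rmult_integral_contrapositive_currified; [|exact Cb].
    assert (B : Rabs (k * e) < PI).
    { rewrite Rabs_mult. apply (Rmult_lt_compat_l (Rabs k)) in He; [|lra].
      replace (Rabs k * (PI / Rabs k)) with PI in He by (field; lra). lra. }
    assert (M : k * e <> 0) by (apply Rmult_integral_contrapositive_currified; auto).
    apply Rabs_def2 in B. destruct (Rlt_dec 0 (k * e)).
    + apply Rgt_not_eq, sin_gt_0; lra.
    + apply Rlt_not_eq, sin_lt_0_var; lra.
  - assert (L : locally (sin b) (fun y => y <> 0)) by (apply (open_neq 0); exact N).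
    apply (continuous_punctured sin k b (continuous_sin b) _ L).
Qed.

Lemma cos_punctured (k b : R) : k <> 0 -> locally' 0 (fun e => cos (k * e + b) <> 0).
Proof.
  intros Hk. generalize (sin_punctured k (PI / 2 + b) Hk). apply filter_imp. intros e.
  rewrite cos_sin. replace (PI / 2 + (k * e + b)) with (k * e + (PI / 2 + b)) by ring. auto.
Qed.

Lemma P1_tan_tendsto (k b : R) : k <> 0 ->
  P1_tendsto (fun e => RtoC (tan (k * e + b))) (P1_tan b).
Proof.
  intros Hk. unfold P1_tan.
  assert (N : locally' 0 (fun e => RtoC (tan (k * e + b)) <> RtoC 0)).
  { generalize (filter_and _ _ (sin_punctured k b Hk) (cos_punctured k b Hk)).
    apply filter_imp. intros e [S K] E. apply RtoC_inj in E. unfold tan in E.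
    apply Rmult_integral in E. destruct E as [E|E]; [auto|]. apply Rinv_neq_0_compat in K. auto. }
  destruct (Req_dec_T (cos b) 0) as [E|Nc].
  - split; [exact N|].
    (* Near a pole the inverse of the tangent is the cotangent, which is continuous there because
       the sine does not vanish. *)
    apply (filterlim_ext_loc (fun e => RtoC (cos (k * e + b) * / sin (k * e + b)))).
    { generalize (filter_and _ _ (sin_punctured k b Hk) (cos_punctured k b Hk)).
      apply filter_imp. intros e [S K]. rewrite <- RtoC_inv.
      - f_equal. unfold tan. field; auto.
      - unfold tan. intros E'. apply Rmult_integral in E'. destruct E' as [E'|E']; [auto|].
        apply Rinv_neq_0_compat in K. auto. }
    apply filterlim_C; [typeclasses eauto| |simpl; apply filterlim_const]. simpl.
    assert (L : filterlim (fun e => cos (k * e + b) * / sin (k * e + b)) (locally' 0)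
      (locally (cos b * / sin b))).
    { apply filterlim_Rmult; [typeclasses eauto|apply continuous_punctured, continuous_cos|].
      apply (continuous_punctured (fun x => / sin x)).
      apply continuous_Rinv_comp; [apply continuous_sin|].
      intros Z. pose proof (sin2_cos2 b) as S. rewrite E, Z in S. unfold Rsqr in S. lra. }
    rewrite E, Rmult_0_l in L. exact L.
  - split; [exact N|]. apply filterlim_C; [typeclasses eauto| |simpl; apply filterlim_const]. simpl.
    apply (continuous_punctured tan).
    apply ex_derive_continuous_R. unfold tan. auto_derive. auto.
Qed.

(** * Values at the integers *)

Definition C_pow_sign (z : C) (n : nat) : C := if Nat.even n then z else (/ z)%C.

Definition C_prod (l : list C) : C := fold_right Cmult (RtoC 1) l.

Lemma C_pow_sign_neq_0 (z : C) (n : nat) : z <> RtoC 0 -> C_pow_sign z n <> RtoC 0.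
Proof. unfold C_pow_sign. destruct (Nat.even n); auto using Cinv_neq_0. Qed.

Lemma C_pow_sign_S (z : C) (n : nat) : z <> RtoC 0 -> C_pow_sign z (S n) = (/ C_pow_sign z n)%C.
Proof.
  intros Nz. unfold C_pow_sign. rewrite Nat.even_succ, <- Nat.negb_even.
  destruct (Nat.even n); simpl; [reflexivity|]. symmetry; apply Cinv_inv, Nz.
Qed.

Lemma C_prod_app (l l' : list C) : C_prod (l ++ l') = (C_prod l * C_prod l')%C.
Proof.
  induction l as [|z l IH]; simpl; [ring|]. unfold C_prod in *. rewrite IH. ring.
Qed.

Lemma C_prod_neq_0 (l : list C) : (forall z, In z l -> z <> RtoC 0) -> C_prod l <> RtoC 0.
Proof.
  induction l as [|z l IH]; simpl; intros H.
  - intros E; apply RtoC_inj in E; lra.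
  - apply Cmult_neq_0; auto.
Qed.

Lemma P1_tendsto_pow_sign (h : R -> C) (p : P1) (n : nat) :
  P1_tendsto h p -> P1_tendsto (fun e => C_pow_sign (h e) n) (P1_pow_sign p n).
Proof.
  intros H. unfold C_pow_sign, P1_pow_sign. destruct (Nat.even n); [exact H|].
  apply P1_tendsto_inv, H.
Qed.

Lemma P1_pow_sign_fin (z : C) (n : nat) : z <> RtoC 0 ->
  P1_pow_sign (P1_fin z) n = P1_fin (C_pow_sign z n).
Proof.
  intros Nz. unfold C_pow_sign, P1_pow_sign. destruct (Nat.even n); [reflexivity|].
  simpl. destruct (Ceq_dec z 0); [contradiction|reflexivity].
Qed.

Lemma P1_prod_cons (p : P1) (l : list P1) :
  P1_prod (p :: l) = match P1_prod l with Some q => P1_mul p q | None => None end.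
Proof. reflexivity. Qed.

Lemma P1_prod_fin (l : list C) : P1_prod (map P1_fin l) = Some (P1_fin (C_prod l)).
Proof.
  induction l as [|z l IH]; [reflexivity|].
  simpl map. rewrite P1_prod_cons, IH. reflexivity.
Qed.

Lemma P1_tendsto_prod {A} (l : list A) (h : A -> R -> C) (p : A -> P1) (r : P1) :
  (forall a, In a l -> P1_tendsto (h a) (p a)) ->
  P1_prod (map p l) = Some r ->
  P1_tendsto (fun e => C_prod (map (fun a => h a e) l)) r.
Proof.
  revert r; induction l as [|a l IH]; intros r H E.
  - injection E as <-. apply (P1_tendsto_real (fun _ => 1)); [lra|apply filterlim_const].
  - simpl map in E. rewrite P1_prod_cons in E.
    destruct (P1_prod (map p l)) as [q|]; [|discriminate].
    apply (P1_tendsto_mul (h a) _ (p a) q); [apply H; left; auto| |exact E].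
    apply IH; [|reflexivity]. intros b Hb; apply H; right; auto.
Qed.

Definition tan_factor (tau e : R) (k : nat) : C := RtoC (tan ((INR k + e) * PI / (2 * tau))).

(** The perturbed right-hand side with [c] in place of [sqrt tau]. The recursion starts from the
    value at [1 + e], which equals [/ sqrt tau] only in the limit; a [c] depending on [e] makes the
    formula exact for small [e <> 0]. *)
Definition C2_product (tau : R) (c : C) (e : R) (m : nat) : C :=
  (C_pow_sign c m * C_prod (map (fun k => C_pow_sign (tan_factor tau e k) (m + k - 1)) (seq 1 (m - 1))))%C.

(** Raising [m] by one flips the parity of every exponent, so all old factors are inverted, and the
    new factor [k = m] has the even exponent [2 * m]. This mirrors the recursion in which
    [C_2 (x + 1)] is a tangent divided by [C_2 (x)]. *)
Lemma C2_product_S (tau : R) (c : C) (e : R) (m : nat) : (1 <= m)%nat ->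
  c <> RtoC 0 -> (forall k, (1 <= k < m)%nat -> tan_factor tau e k <> RtoC 0) ->
  C2_product tau c e (S m) = (tan_factor tau e m / C2_product tau c e m)%C.
Proof.
  intros Hm Nc Nt. unfold C2_product.
  replace (S m - 1)%nat with (S (m - 1)) by lia.
  rewrite seq_S, map_app, C_prod_app, C_pow_sign_S by auto.
  replace (1 + (m - 1))%nat with m by lia. simpl map at 2. unfold C_prod at 2; simpl.
  replace (C_pow_sign (tan_factor tau e m) (m + m - 0)) with (tan_factor tau e m).
  2:{ unfold C_pow_sign. replace (m + m - 0)%nat with (2 * m)%nat by lia.
      rewrite Nat.even_mul. reflexivity. }
  assert (E : forall l, (forall k, In k l -> (1 <= k < m)%nat) ->
    C_prod (map (fun k => C_pow_sign (tan_factor tau e k) (m + k - 0)) l)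
    = (/ C_prod (map (fun k => C_pow_sign (tan_factor tau e k) (m + k - 1)) l))%C).
  { induction l as [|k l IH]; intros Hl.
    - simpl. field.
    - pose proof (Hl k (or_introl eq_refl)) as Hk.
      change (C_pow_sign (tan_factor tau e k) (m + k - 0) *
        C_prod (map (fun k => C_pow_sign (tan_factor tau e k) (m + k - 0)) l)
        = / (C_pow_sign (tan_factor tau e k) (m + k - 1) *
        C_prod (map (fun k => C_pow_sign (tan_factor tau e k) (m + k - 1)) l)))%C.
      rewrite IH by (intros j Hj; apply Hl; right; auto).
      replace (m + k - 0)%nat with (S (m + k - 1)) by lia.
      rewrite C_pow_sign_S by auto. rewrite Cinv_mul; [reflexivity| |].
      + apply C_pow_sign_neq_0; auto.
      + apply C_prod_neq_0. intros z Hz. apply in_map_iff in Hz. destruct Hz as [j [<- Hj]].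
        apply C_pow_sign_neq_0, Nt, Hl. right; auto. }
  rewrite E by (intros k Hk; apply in_seq in Hk; lia).
  field. split.
  - apply C_prod_neq_0. intros z Hz. apply in_map_iff in Hz. destruct Hz as [j [<- Hj]].
    apply C_pow_sign_neq_0, Nt. apply in_seq in Hj; lia.
  - apply C_pow_sign_neq_0; auto.
Qed.

Lemma P1_tan_factor (tau : R) (k : nat) : 0 < tau ->
  P1_tendsto (fun e => tan_factor tau e k) (P1_tan ((INR k + 0) * PI / (2 * tau))).
Proof.
  intros Ht. pose proof PI_RGT_0.
  apply (P1_tendsto_ext (fun e => RtoC (tan (PI / (2 * tau) * e + (INR k + 0) * PI / (2 * tau))))).
  - apply filter_forall. intros e. unfold tan_factor. do 2 f_equal. field. lra.
  - apply P1_tan_tendsto. apply Rgt_not_eq, Rdiv_lt_0_compat; lra.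
Qed.

Lemma tan_factor_near (tau : R) (m : nat) : 0 < tau ->
  locally' 0 (fun e => forall k, (k < m)%nat -> tan_factor tau e k <> RtoC 0).
Proof.
  intros Ht. induction m as [|m IH].
  - apply filter_forall. intros e k Hk. lia.
  - generalize (filter_and _ _ IH (proj1 (P1_tan_factor tau m Ht))).
    apply filter_imp. intros e [A B] k Hk.
    destruct (Nat.eq_dec k m) as [->|]; [exact B|]. apply A. lia.
Qed.

(* With the junk value [tan y = 0] where [cos y = 0], [tan y <> 0] forces [cos y <> 0]. *)
Lemma P1_tan_fin (y : R) : RtoC (tan y) <> RtoC 0 -> P1_tan y = P1_fin (RtoC (tan y)).
Proof.
  intros N. unfold P1_tan. destruct (Req_dec_T (cos y) 0) as [E|]; [|reflexivity].
  exfalso. apply N. unfold tan. rewrite E. unfold Rdiv. rewrite Rinv_0, Rmult_0_r. reflexivity.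
Qed.

(** For small [e] this is the value of [C_2] at [1 + e]. *)
Definition gam_quotient (tau : R) (Gam : C -> P1) (e : R) : R := gam Gam (tau - e) / gam Gam (1 + e).

(** Induction on [m] with [reflection_all] at [x = m + e]. Positive arguments cause no trouble;
    [Gam] at [1 + tau - x] is in [C^*] by induction, and the non-zero sine and cosine then force the
    same at [tau - x]. *)
Lemma C2_near (tau : R) (Gam : C -> P1) (m : nat) : 0 < tau -> is_Gamma_bar2 tau Gam ->
  (1 <= m)%nat ->
  locally' 0 (fun e => exists w : C, w <> RtoC 0 /\
    Gam (RtoC (-1 * e + (1 + tau - INR m))) = P1_fin w /\
    (w / RtoC (gam Gam (INR m + e)))%C
    = C2_product tau (/ RtoC (gam_quotient tau Gam e))%C e m).
Proof.
  intros Ht HG Hm.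
  assert (Hq : locally' 0 (fun e => 0 < gam_quotient tau Gam e /\ - 1 < e < tau)).
  { exists (mkposreal (Rmin tau 1) ltac:(apply Rmin_pos; lra)). intros e He _.
    unfold ball in *; simpl in *; unfold AbsRing_ball, abs, minus, plus, opp in *; simpl in *.
    rewrite Ropp_0, Rplus_0_r in He. apply Rabs_def2 in He.
    pose proof (Rmin_l tau 1). pose proof (Rmin_r tau 1). split; [|lra].
    apply Rdiv_lt_0_compat; apply (gam_pos tau Gam _ Ht HG); lra. }
  assert (Hneq : forall r, 0 < r -> RtoC r <> RtoC 0) by (intros r Hr E; apply RtoC_inj in E; lra).
  induction Hm as [|m Hm IH].
  - generalize Hq. apply filter_imp. intros e [Hp He].
    destruct (gam_pos tau Gam (tau - e) Ht HG ltac:(lra)) as [P E].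
    destruct (gam_pos tau Gam (1 + e) Ht HG ltac:(lra)) as [P' _].
    exists (RtoC (gam Gam (tau - e))). split; [auto|]. split.
    + simpl INR. replace (-1 * e + (1 + tau - 1)) with (tau - e) by ring. exact E.
    + unfold C2_product, C_pow_sign, C_prod. simpl. rewrite Cinv_inv by auto.
      unfold gam_quotient. rewrite RtoC_div by lra. ring.
  - pose proof (tan_factor_near tau (S m) Ht) as Hks.
    generalize (filter_and _ _ (filter_and _ _ IH Hq) Hks). apply filter_imp.
    intros e [[[w [Nw [Ew Hw]]] [Hp He]] Nt].
    assert (Hm1 : 1 <= INR m) by (apply (le_INR 1); exact Hm).
    set (x := INR m + e) in *.
    pose proof (reflection_all tau Gam Ht HG x ltac:(unfold x; lra)) as Rf. unfold reflection_at in Rf.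
    destruct (gam_pos tau Gam x Ht HG ltac:(unfold x; lra)) as [Px Ex].
    destruct (gam_pos tau Gam (x + 1) Ht HG ltac:(unfold x; lra)) as [Px1 Ex1].
    replace (-1 * x + (1 + tau)) with (-1 * e + (1 + tau - INR m)) in Rf by (unfold x; ring).
    replace (1 * x + 0) with x in Rf by ring. replace (1 * x + 1) with (x + 1) in Rf by ring.
    rewrite Ew, Ex, Ex1 in Rf. simpl in Rf.
    replace (-1 * e + (1 + tau - INR (S m))) with (-1 * x + tau) by (rewrite S_INR; unfold x; ring).
    replace (INR (S m) + e) with (x + 1) by (rewrite S_INR; unfold x; ring).
    rewrite Rplus_0_r in Rf.
    replace (PI / (2 * tau) * x + PI / 2) with (PI / 2 + PI / (2 * tau) * x) in Rf by ring.
    rewrite <- cos_sin in Rf.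
    pose proof (Nt m ltac:(lia)) as Ntm.
    assert (Et : tan_factor tau e m = (RtoC (sin (PI / (2 * tau) * x)) / RtoC (cos (PI / (2 * tau) * x)))%C
       /\ RtoC (sin (PI / (2 * tau) * x)) <> RtoC 0 /\ RtoC (cos (PI / (2 * tau) * x)) <> RtoC 0).
    { unfold tan_factor in *. replace ((INR m + e) * PI / (2 * tau)) with (PI / (2 * tau) * x) in *
        by (unfold x; field; lra).
      unfold tan in *. set (s := sin _) in *. set (c := cos _) in *.
      assert (Nc : c <> 0).
      { intros Z. apply Ntm. rewrite Z. unfold Rdiv. rewrite Rinv_0, Rmult_0_r. reflexivity. }
      assert (Ns : s <> 0).
      { intros Z. apply Ntm. rewrite Z. unfold Rdiv. rewrite Rmult_0_l. reflexivity. }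
      split; [apply RtoC_div; auto|]. split; intros E; apply RtoC_inj in E; auto. }
    destruct Et as [Et [Ns Nc]].
    rewrite C2_product_S, Et, <- Hw; [|exact Hm|apply Cinv_neq_0; auto|intros k Hk; apply Nt; lia].
    pose proof (Hneq _ Px) as NPx. pose proof (Hneq _ Px1) as NPx1.
    destruct (Gam (RtoC (-1 * x + tau))) as [w'|]; simpl in Rf.
    + exists w'.
      assert (Rf' : (w * w' * RtoC (cos (PI / (2 * tau) * x))
        = RtoC (gam Gam x) * RtoC (gam Gam (x + 1)) * RtoC (sin (PI / (2 * tau) * x)))%C).
      { transitivity (w * w' * (RtoC 1 * RtoC 1) * RtoC (cos (PI / (2 * tau) * x)))%C; [ring|].
        rewrite Rf. ring. }
      split; [|split; [reflexivity|]].
      * intros Z. rewrite Z in Rf'.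
        apply (Cmult_neq_0 _ _ (Cmult_neq_0 _ _ NPx NPx1) Ns). rewrite <- Rf'. ring.
      * assert (E : w' = (RtoC (gam Gam x) * RtoC (gam Gam (x + 1)) * RtoC (sin (PI / (2 * tau) * x))
           / (w * RtoC (cos (PI / (2 * tau) * x))))%C).
        { rewrite <- Rf'. field. auto. }
        rewrite E. field. repeat split; auto.
    (* A pole at [tau - x] annihilates the right-hand side of the relation and leaves [w] times the
       cosine equal to 0. *)
    + exfalso. apply (Cmult_neq_0 _ _ Nw Nc).
      transitivity (w * 1 * (1 * 1) * RtoC (cos (PI / (2 * tau) * x)))%C; [ring|].
      rewrite Rf. ring.
Qed.

(** The factor at [m] is finite and non-zero, so the product defining [C_2] is determinate even if
    the other factor is a zero or a pole; continuity of both factors in [e] identifies it as the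
    limit of the perturbed formula. *)
Lemma C2_value (tau : R) (Gam : C -> P1) (m : nat) : 0 < tau -> is_Gamma_bar2 tau Gam ->
  (1 <= m)%nat ->
  exists v, C2 tau Gam (RtoC (INR m)) = Some v /\
    P1_tendsto (fun e => C2_product tau (/ RtoC (gam_quotient tau Gam e))%C e m) v.
Proof.
  intros Ht HG Hm.
  assert (Hm1 : 1 <= INR m) by (apply (le_INR 1); exact Hm).
  destruct (gam_pos tau Gam (INR m) Ht HG ltac:(lra)) as [P E].
  assert (NP : RtoC (gam Gam (INR m)) <> RtoC 0) by (intros Z; apply RtoC_inj in Z; lra).
  unfold C2. rewrite E. simpl. destruct (Ceq_dec _ _) as [|_]; [contradiction|].
  rewrite <- RtoC_plus, <- RtoC_minus.
  pose (w := fun e => P1_num (Gam (RtoC (-1 * e + (1 + tau - INR m))))).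
  assert (Hw : locally' 0 (fun e => w e <> RtoC 0 /\
    Gam (RtoC (-1 * e + (1 + tau - INR m))) = P1_fin (w e) /\
    (w e * / RtoC (gam Gam (INR m + e)))%C
    = C2_product tau (/ RtoC (gam_quotient tau Gam e))%C e m)).
  { generalize (C2_near tau Gam m Ht HG Hm). apply filter_imp. intros e [z [Nz [Ez Hz]]].
    unfold w. rewrite Ez. simpl. auto. }
  assert (T : P1_tendsto w (Gam (RtoC (1 + tau - INR m)))).
  { apply (P1_meromorphic_tendsto Gam (-1) _ _ (proj2 HG)).
    generalize Hw. apply filter_imp. intros e [A [B _]]; auto. }
  assert (Tg : P1_tendsto (fun e => RtoC (gam Gam (1 * e + INR m))) (P1_fin (RtoC (gam Gam (INR m))))).
  { apply P1_tendsto_real; [lra|]. apply (continuous_punctured (gam Gam)).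
    apply (gam_continuous tau); auto; lra. }
  apply P1_tendsto_inv in Tg. simpl in Tg. destruct (Ceq_dec _ _) as [|_] in Tg; [contradiction|].
  pose proof (Cinv_neq_0 _ NP) as NI.
  set (g := (/ RtoC (gam Gam (INR m)))%C) in *.
  assert (Ex : exists v, P1_mul (P1_fin g) (Gam (RtoC (1 + tau - INR m))) = Some v).
  { destruct (Gam (RtoC (1 + tau - INR m))) as [z|]; simpl; [eauto|].
    destruct (Ceq_dec g 0); [contradiction|eauto]. }
  destruct Ex as [v Ev]. exists v. split; [exact Ev|].
  eapply P1_tendsto_ext; [|exact (P1_tendsto_mul _ _ _ _ _ Tg T Ev)].
  generalize Hw. apply filter_imp. intros e [_ [_ <-]]. cbv beta.
  rewrite Rmult_1_l, (Rplus_comm e). apply Cmult_comm.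
Qed.

Lemma gam_quotient_lim (tau : R) (Gam : C -> P1) : 0 < tau -> is_Gamma_bar2 tau Gam ->
  filterlim (gam_quotient tau Gam) (locally' 0) (locally (/ sqrt tau)).
Proof.
  intros Ht HG. rewrite <- (gam_ratio tau Gam Ht HG).
  apply (filterlim_ext (fun e => gam Gam (-1 * e + tau) * / gam Gam (1 * e + 1))).
  { intros e. unfold gam_quotient, Rdiv. do 2 f_equal; [|f_equal]; ring. }
  apply filterlim_Rmult; [typeclasses eauto| |].
  - apply (continuous_punctured (gam Gam)), (gam_continuous tau); auto.
  - apply (continuous_punctured (fun x => / gam Gam x)).
    apply continuous_Rinv_comp; [apply (gam_continuous tau); auto; lra|].
    apply Rgt_not_eq, (gam_pos tau Gam 1 Ht HG). lra.
Qed.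

(** The two products differ by the factor [sqrt tau * gam_quotient tau Gam e] or its inverse. This
    tends to 1, so the limit in the projective line is unchanged. *)
Lemma C2_product_tendsto (tau : R) (Gam : C -> P1) (m : nat) (v : P1) :
  0 < tau -> is_Gamma_bar2 tau Gam ->
  P1_tendsto (fun e => C2_product tau (/ RtoC (gam_quotient tau Gam e))%C e m) v ->
  P1_tendsto (fun e => C2_product tau (RtoC (sqrt tau)) e m) v.
Proof.
  intros Ht HG T. pose proof (sqrt_lt_R0 tau Ht) as Ps.
  assert (Ns : RtoC (sqrt tau) <> RtoC 0) by (intros Z; apply RtoC_inj in Z; lra).
  assert (Tq : P1_tendsto (fun e => RtoC (sqrt tau * gam_quotient tau Gam e)) (P1_fin (RtoC 1))).
  { apply P1_tendsto_real; [lra|]. replace 1 with (sqrt tau * / sqrt tau) at 1 by (field; lra).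
    apply filterlim_Rmult; [typeclasses eauto|apply filterlim_const|apply gam_quotient_lim; auto]. }
  pose proof (proj1 Tq) as Nq.
  apply (P1_tendsto_pow_sign _ _ m) in Tq.
  replace (P1_pow_sign (P1_fin 1) m) with (P1_fin (RtoC 1)) in Tq.
  2:{ unfold P1_pow_sign. destruct (Nat.even m); [reflexivity|]. simpl.
      destruct (Ceq_dec 1 0) as [Z|_]; [apply RtoC_inj in Z; lra|].
      f_equal. field. }
  assert (E : P1_mul (P1_fin (RtoC 1)) v = Some v).
  { destruct v as [z|]; simpl; [do 2 f_equal; ring|].
    destruct (Ceq_dec 1 0) as [Z|_]; [apply RtoC_inj in Z; lra|reflexivity]. }
  eapply P1_tendsto_ext; [|exact (P1_tendsto_mul _ _ _ _ _ Tq T E)].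
  generalize Nq. apply filter_imp. intros e Ne. unfold C2_product.
  rewrite RtoC_mult in *. set (q := RtoC (gam_quotient tau Gam e)) in *.
  assert (Nq' : q <> RtoC 0) by (intros Z; apply Ne; rewrite Z; ring).
  set (L := C_prod _). unfold C_pow_sign.
  destruct (Nat.even m); field; auto using Cinv_neq_0.
Qed.

Theorem proposition3p16 :
  forall (tau : R), 0 < tau ->
  forall (Gam : C -> P1), is_Gamma_bar2 tau Gam ->
  forall (m : nat), (2 <= m)%nat ->
  exists v : P1,
    C2 tau Gam (RtoC (INR m)) = Some v /\
    P1_value_at0
      (fun e : R =>
         P1_prod
           (P1_pow_sign (P1_fin (RtoC (sqrt tau))) m ::
            map (fun k : nat =>
                   P1_pow_sign (P1_tan ((INR k + e) * PI / (2 * tau)))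
                     (m + k - 1))
              (seq 1 (m - 1))))
      v.
Proof.
  intros tau Ht Gam HG m Hm.
  destruct (C2_value tau Gam m Ht HG ltac:(lia)) as [v [Ev T]].
  exists v. split; [exact Ev|].
  apply (C2_product_tendsto tau Gam m v Ht HG) in T.
  set (f := fun e : R => P1_prod _).
  pose proof (sqrt_lt_R0 tau Ht) as Ps.
  assert (Ns : RtoC (sqrt tau) <> RtoC 0) by (intros Z; apply RtoC_inj in Z; lra).
  destruct (f 0) as [v'|] eqn:E; [left|right].
  (* A determinate product at [e = 0] is the limit of the perturbed product, since every factor is
     continuous into the projective line; uniqueness of limits gives [v]. *)
  - rewrite E. f_equal. unfold f in E. rewrite P1_prod_cons in E.
    destruct (P1_prod (map _ _)) as [q|] eqn:Eq; [|discriminate].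
    rewrite P1_pow_sign_fin in E by exact Ns.
    apply (P1_tendsto_unique (fun e => C2_product tau (RtoC (sqrt tau)) e m)); [|exact T].
    apply (P1_tendsto_mul (fun _ => C_pow_sign (RtoC (sqrt tau)) m) _ (P1_fin (C_pow_sign (RtoC (sqrt tau)) m)) q);
      [| |exact E].
    + split; [|apply filterlim_const]. apply filter_forall. intros _. apply C_pow_sign_neq_0, Ns.
    + apply (P1_tendsto_prod (seq 1 (m - 1))
        (fun k e => C_pow_sign (tan_factor tau e k) (m + k - 1))
        (fun k => P1_pow_sign (P1_tan ((INR k + 0) * PI / (2 * tau))) (m + k - 1))); [|exact Eq].
      intros k _. apply P1_tendsto_pow_sign, P1_tan_factor, Ht.
  (* In the indeterminate case all factors are finite and non-zero for small [e <> 0], so the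
     projective product there is the ordinary [C2_product], whose limit is known. *)
  - split; [exact E|].
    apply (P1_tendsto_lim0 f (fun e => C2_product tau (RtoC (sqrt tau)) e m)); [|exact T].
    generalize (tan_factor_near tau m Ht). apply filter_imp. intros e Nt.
    unfold f, C2_product. rewrite P1_prod_cons, P1_pow_sign_fin by exact Ns.
    rewrite (map_ext_in _ (fun k => P1_fin (C_pow_sign (tan_factor tau e k) (m + k - 1)))).
    + rewrite <- map_map with (g := P1_fin), P1_prod_fin. reflexivity.
    + intros k Hk. apply in_seq in Hk. specialize (Nt k ltac:(lia)). unfold tan_factor in Nt.
      rewrite P1_tan_fin by exact Nt. apply P1_pow_sign_fin, Nt.
Qed.
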